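(* Let $k$ be a field and let $A$ be a pseudocompact $k$-algebra. The following subsets of $A$ are equal: (1) the intersection of the maximal closed left ideals of $A$; (2) the intersection of the maximal closed right ideals of $A$; (3) the intersection of the maximal closed two-sided ideals of $A$; (4) the intersection of the (not necessarily closed) maximal left ideals of $A$; (5) $\{x\in A \mid 1-yx \text{ is left invertible for any } y\in A\}$; (6) $\{x\in A \mid 1-yxz \text{ is invertible for any } y,z\in A\}$; (7) the set of all non-generators of $A$; (8) the set of all topological non-generators of $A$; (9) the intersection of the annihilators of the simple pseudocompact left $A$-modules; (10) the smallest closed submodule $V$ of $A$ (i.e. closed left ideal) such that $A/V$ is a product of simple pseudocompact $A$-modules; (11) the maximal (i.e. largest) closed pronilpotent ideal of $A$.
   Context: $k$ is a field with the discrete topology. A pseudocompact $k$-algebra is a topological (associative, unital) $k$-algebra that is an inverse limit of discrete finite dimensional $k$-algebras and algebra homomorphisms; equivalently, it has a basis of neighbourhoods of $0$ consisting of (two-sided) ideals of finite codimension whose intersection is $0$, and it is complete. A discrete $A$-module is an $A$-module $U$ with the discrete topology such that the multiplication $A\times U\to U$ is continuous. A pseudocompact $A$-module is an inverse limit of discrete finite dimensional $A$-modules. Modules are left modules. A simple pseudocompact $A$-module is a non-zero pseudocompact $A$-module whose only closed submodules are $0$ and itself. Products of modules carry the product topology. A maximal closed (left, right, two-sided) ideal is a proper closed (left, right, two-sided) ideal that is maximal among proper closed ideals of that kind. An element $a\in A$ is a non-generator if whenever $X$ is a subset of $A$ such that the left ideal generated by $X\cup\{a\}$ is $A$, then the left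 ideal generated by $X$ is already $A$. It is a topological non-generator if whenever $X$ is a subset of $A$ such that the closed left ideal generated by $X\cup\{a\}$ is $A$, then the closed left ideal generated by $X$ is already $A$. For closed ideals $I,I'$ of $A$, $I\cdot I'$ denotes the topological closure of the abstract product of $I$ and $I'$; $I^n$ is defined recursively by $I^1=I$ and $I^n=I^{n-1}\cdot I$. A closed (two-sided) ideal $I$ is pronilpotent if $\bigcap_{n\in\mathbb{N}}I^n=0$. *)

(* Defs.v *)
From HB Require Import structures.
From mathcomp Require Import all_boot all_order all_algebra.
From mathcomp Require Import all_classical.
From mathcomp Require Import topology pseudometric_normed_Zmodule.

Set Implicit Arguments.
Unset Strict Implicit.
Unset Printing Implicit Defensive.

Import GRing.Theory.

Local Open Scope classical_set_scope.
Local Open Scope ring_scope.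

(* Associative unital k-algebras, given as rings with a central ring morphism
   from k. MathComp's [algType] is not used because it excludes the zero ring,
   which is a pseudocompact algebra. *)
HB.mixin Record PzRing_isCentralAlgebra (k : fieldType) (A : Type)
    of GRing.PzRing A := {
  scalar_map : {rmorphism k -> A} ;
  scalar_map_central : forall (c : k) (x : A), GRing.comm (scalar_map c) x
}.

#[short(type="pzAlgType")]
HB.structure Definition PzAlgebra (k : fieldType) :=
  {A of GRing.PzRing A & PzRing_isCentralAlgebra k A}.

(* As for the [PreTopological] structures of the library, the operations are not
   required to be continuous: this is automatic for inverse limits of discrete
   objects, hence for pseudocompact algebras and modules. *)
#[short(type="preTopologicalPzAlgType")]
HB.structure Definition PreTopologicalPzAlgebra (k : fieldType) :=
  {A of Topological A & PzAlgebra k A}.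

#[short(type="preTopologicalModType")]
HB.structure Definition PreTopologicalModule (R : pzRingType) :=
  {M of Topological M & GRing.Lmodule R M}.

Section InverseLimit.

Definition directed (I : Type) (le : I -> I -> Prop) : Prop :=
  [/\ inhabited I, forall i, le i i,
      forall i j l, le i j -> le j l -> le i l
    & forall i j, exists l, le i l /\ le j l].

Variables (I : Type) (le : I -> I -> Prop).

Definition inverse_system (U : I -> Type)
    (phi : forall i j, le i j -> U j -> U i) : Prop :=
  (forall i (h : le i i) u, phi i i h u = u) /\
  (forall i j l (hij : le i j) (hjl : le j l) (hil : le i l) u,
     phi i l hil u = phi i j hij (phi j l hjl u)).

(* X, with the projections p, is the limit of the system: it corresponds
   bijectively to the compatible families, and it carries the topology induced
   by the product topology. *)
Definition is_inverse_limit (U : I -> topologicalType)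
    (phi : forall i j, le i j -> U j -> U i)
    (X : topologicalType) (p : forall i, X -> U i) : Prop :=
  [/\ forall i j (h : le i j) x, phi i j h (p j x) = p i x,
      forall u : (forall i, U i),
        (forall i j (h : le i j), phi i j h (u j) = u i) ->
        exists! x, forall i, p i x = u i
    & forall O : set X, open O <->
        exists2 W : set (prod_topology U), open W
          & O = (fun x i => p i x) @^-1` W].

End InverseLimit.

Section Pseudocompact.
Variable k : fieldType.

Definition finite_dimensional (A : pzAlgType k) (U : lmodType A) : Prop :=
  exists (n : nat) (e : 'I_n -> U), forall u : U,
  exists c : 'I_n -> k, u = \sum_(i < n) (scalar_map (c i) : A) *: e i.

Definition algebra_morphism (A B : pzAlgType k) (f : A -> B) : Prop :=
  [/\ zmod_morphism f, monoid_morphism f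
    & forall c : k, f (scalar_map c) = scalar_map c].

Definition pseudocompact_algebra (A : preTopologicalPzAlgType k) : Prop :=
  exists (I : Type) (le : I -> I -> Prop) (B : I -> pzAlgType k)
    (phi : forall i j, le i j -> B j -> B i) (p : forall i, A -> B i),
  [/\ directed le,
      forall i, finite_dimensional (B i)^o,
      inverse_system phi /\
        (forall i j (h : le i j), algebra_morphism (phi i j h)),
      forall i, algebra_morphism (p i)
    & is_inverse_limit (U := fun i => discrete_topology (B i)) phi p].

Variable A : preTopologicalPzAlgType k.

Definition discrete_module (U : lmodType A) : Prop :=
  continuous (fun x : A * discrete_topology U =>
    (x.1 *: (x.2 : U)) : discrete_topology U).

Definition pseudocompact_module (M : preTopologicalModType A) : Prop :=
  exists (I : Type) (le : I -> I -> Prop) (U : I -> lmodType A)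
    (phi : forall i j, le i j -> U j -> U i) (p : forall i, M -> U i),
  [/\ directed le,
      forall i, finite_dimensional (U i) /\ discrete_module (U i),
      inverse_system phi /\ (forall i j (h : le i j), linear (phi i j h)),
      forall i, linear (p i)
    & is_inverse_limit (U := fun i => discrete_topology (U i)) phi p].

Definition simple_pseudocompact (S : preTopologicalModType A) : Prop :=
  [/\ pseudocompact_module S, exists s : S, s != 0
    & forall N : submodClosed S, closed [set` N] ->
        [set` N] = [set 0] \/ [set` N] = setT].

(* The product module has the pointwise operations, so that linearity of a map
   into it is linearity of the components. *)
Definition product_of_simples (M : preTopologicalModType A) : Prop :=
  exists (I : Type) (S : I -> preTopologicalModType A)
    (f : M -> prod_topology S) (g : prod_topology S -> M),
  [/\ forall i, simple_pseudocompact (S i),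
      forall i, linear (fun x => f x i),
      cancel f g /\ cancel g f
    & continuous f /\ continuous g].

End Pseudocompact.

(* A as a left module over itself, with its own topology; the library alias A^o
   is avoided because it carries the norm topology for a [numDomainType]. *)
Definition left_regular (A : Type) : Type := A.

Section LeftRegular.
Variables (k : fieldType) (A : preTopologicalPzAlgType k).
HB.instance Definition _ := Topological.copy (left_regular A) A.
HB.instance Definition _ := GRing.Lmodule.copy (left_regular A) A^o.
End LeftRegular.

Section QuotientModule.
Context {R : pzRingType} {M : preTopologicalModType R} (N : submodClosed M).
Local Open Scope quotient_scope.

Definition submod_zmodClosed : zmodClosed M :=
  HB.pack (GRing.SubmodClosed.sort N)
    (GRing.isZmodClosed.Build M (GRing.SubmodClosed.sort N)
      (GRing.submod_closedB (submodClosedP N))).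

Local Notation Q := (Quotient.quot submod_zmodClosed).

Definition quotient_module : Type := quotient_topology Q.

HB.instance Definition _ := Topological.on quotient_module.
HB.instance Definition _ := GRing.isZmodule.Build quotient_module
  (@Quotient.addqA M submod_zmodClosed) (@Quotient.addqC M submod_zmodClosed)
  (@Quotient.add0q M submod_zmodClosed) (@Quotient.addNq M submod_zmodClosed).

Definition quotient_scale (a : R) (x : quotient_module) : quotient_module :=
  \pi_Q (a *: repr (x : Q)).

Lemma quotient_scale_pi a (x : M) :
  quotient_scale a (\pi_Q x) = \pi_Q (a *: x).
Proof.
have piE (u v : M) : u - v \in (N : {pred M}) = (\pi_Q u == \pi_Q v).
  exact: (Quotient.idealrBE submod_zmodClosed u v).
by apply/(@eqP Q); rewrite -piE -scalerBr rpredZ // piE reprK.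
Qed.

Lemma quotient_scalerA a b x :
  quotient_scale a (quotient_scale b x) = quotient_scale (a * b) x.
Proof. by rewrite [quotient_scale b x]/quotient_scale quotient_scale_pi scalerA. Qed.

Lemma quotient_scale1r : left_id 1 quotient_scale.
Proof. by move=> x; rewrite /quotient_scale scale1r reprK. Qed.

Lemma quotient_scalerDr : right_distributive quotient_scale +%R.
Proof.
move=> a x y; rewrite -[x](@reprK _ Q) -[y](@reprK _ Q).
rewrite !quotient_scale_pi.
have piD (u v : M) : (\pi_Q u : quotient_module) + \pi_Q v = \pi_Q (u + v).
  by rewrite -[RHS]/(\pi_Q (u + v)) [RHS]raddfD.
by rewrite !piD quotient_scale_pi scalerDr.
Qed.

Lemma quotient_scalerDl x : {morph quotient_scale^~ x : a b / a + b}.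
Proof.
move=> a b; rewrite -[x](@reprK _ Q).
by rewrite !quotient_scale_pi scalerDl [LHS]raddfD.
Qed.

HB.instance Definition _ := GRing.Zmodule_isLmodule.Build R quotient_module
  quotient_scalerA quotient_scale1r quotient_scalerDr quotient_scalerDl.

End QuotientModule.

Section Ideals.
Variables (k : fieldType) (A : preTopologicalPzAlgType k).
Implicit Types (I J X V : set A) (a x y z : A).

Definition left_ideal I : Prop :=
  [/\ I 0, forall x y, I x -> I y -> I (x + y)
    & forall a x, I x -> I (a * x)].

Definition right_ideal I : Prop :=
  [/\ I 0, forall x y, I x -> I y -> I (x + y)
    & forall a x, I x -> I (x * a)].

Definition twosided_ideal I : Prop := left_ideal I /\ right_ideal I.

Definition closed_left_ideal I : Prop := closed I /\ left_ideal I.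
Definition closed_right_ideal I : Prop := closed I /\ right_ideal I.
Definition closed_ideal I : Prop := closed I /\ twosided_ideal I.

Definition maximal_proper (P : set A -> Prop) : set (set A) :=
  [set I | [/\ P I, I <> setT
             & forall J, P J -> J <> setT -> I `<=` J -> J = I]].

Definition left_invertible x : Prop := exists y, y * x = 1.
Definition invertible x : Prop := exists y, y * x = 1 /\ x * y = 1.

Definition non_generator a : Prop :=
  forall X, smallest left_ideal (X `|` [set a]) = setT ->
    smallest left_ideal X = setT.

Definition topological_non_generator a : Prop :=
  forall X, smallest closed_left_ideal (X `|` [set a]) = setT ->
    smallest closed_left_ideal X = setT.

Definition annihilator (M : lmodType A) : set A :=
  [set a | forall m : M, a *: m = 0].

Definition ideal_product I J : set A :=
  [set x | exists (n : nat) (u v : 'I_n -> A),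
     (forall i, I (u i) /\ J (v i)) /\ x = \sum_(i < n) u i * v i].

(* [closed_power I n] is I^(n+1), so that the powers start at I^1 = I. *)
Fixpoint closed_power I (n : nat) : set A :=
  if n is m.+1 then closure (ideal_product (closed_power I m) I) else I.

Definition pronilpotent I : Prop := \bigcap_n closed_power I n = [set 0].

Definition closed_pronilpotent_ideal I : Prop :=
  closed_ideal I /\ pronilpotent I.

(* V is a closed left ideal such that A / V is a product of simple pseudocompact
   modules; closed left ideals are here bundled as submodules of A. *)
Definition closed_with_product_of_simples_quotient V : Prop :=
  exists W : submodClosed (left_regular A),
    [/\ V = [set` W], closed V & product_of_simples (quotient_module W)].

Definition is_smallest (P : set A -> Prop) V : Prop :=
  P V /\ forall V', P V' -> V `<=` V'.

Definition is_largest (P : set A -> Prop) V : Prop :=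
  P V /\ forall V', P V' -> V' `<=` V.

End Ideals.

(* Main.v *)
Require Import Defs.
From HB Require Import structures.
From mathcomp Require Import all_boot all_order all_algebra.
From mathcomp Require Import all_classical.
From mathcomp Require Import topology.

(** The common value of the eleven sets is the Jacobson radical J, taken here as
    the set of all x such that 1 - y x is left invertible for every y.  In any
    ring, J is the intersection of the maximal left ideals, it is a two-sided
    ideal, it consists of the x such that every 1 - y x z is invertible, a
    left-right symmetric condition, and it is the set of non-generators.

    Topology enters through a directed family K_i of open two-sided ideals with
    zero intersection, for which A is complete and each A / K_i is finite
    dimensional ([pseudocompact_base_of_algebra]).  Most of the argument takes place in a
    ring R equipped with such a family, so that it also applies to the opposite
    ring.  A closed left ideal without 1 is already proper modulo some K_i, hence
    the maximal closed left ideals are exactly the maximal left ideals that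
    contain some K_i ([open_maximalE]).  If x lies in all of them, then 1 - x is left
    invertible modulo each K_i, and so are its left inverses; hence inverses of
    1 - x modulo K_i are unique and completeness glues them to an inverse in R
    ([jacobson_open_maximal]).  So J is also the intersection of the maximal closed
    left ideals and, by symmetry, of the maximal closed right ideals; the
    description by topological non-generators follows formally.

    For two-sided ideals, let P be the annihilator of R / M with M an open maximal
    left ideal.  A two-sided ideal Q containing P has a complement C modulo P, and
    Q C is contained in P, which forces Q = P or Q = R: thus P is a maximal
    two-sided ideal ([open_maximal_ann]).

    The rest relies on linear compactness ([linearly_compact]): closed cosets of
    left ideals with the finite intersection property have a common point.  By
    Zorn such a family lies in a maximal one; since R / K_i is artinian the
    maximal family contains a coset of each K_i, and completeness provides the
    point.  Consequently a family of closed left ideals with intersection N has,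
    for each i, a finite intersection inside N + K_i ([chevalley]).

    A maximal family F of open maximal left ideals, none of which contains a
    finite intersection of the others, has intersection J ([ex_coindep]), and
    linear compactness makes A -> prod_(M in F) A / M surjective; the induced
    bijection from A / J is a homeomorphism by [chevalley].  Conversely J kills
    every simple pseudocompact module, hence every product of them, so J lies in
    every closed left ideal V such that A / V is a product of simples.

    Finally, the powers of J vanish modulo each K_i by the argument used for
    artinian rings ([jacobson_pronilpotent]), and an element z of a closed
    pronilpotent ideal is nilpotent modulo each K_i, so 1 - z lies in no open
    maximal left ideal ([pronilpotent_sub_jacobson]). *)

Set Implicit Arguments.
Unset Strict Implicit.
Unset Printing Implicit Defensive.

Import GRing.Theory.
Local Open Scope classical_set_scope.
Local Open Scope ring_scope.

(** * Zorn's lemma and finite intersections *)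

(** Zorn's lemma for inclusion, above a given set and for nonempty chains only. *)
Lemma zorn_above (T : Type) (P : set (set T)) (X0 : set T) : P X0 ->
  (forall F : set (set T), F `<=` P -> F !=set0 -> total_on F subset ->
    P (\bigcup_(X in F) X)) ->
  exists A, [/\ P A, X0 `<=` A & forall B, A `<=` B -> P B -> B = A].
Proof.
move=> PX0 chain.
(* [Zorn_bigcup] also asks for the union of the empty chain, hence the set0. *)
pose P' := [set X | (P X /\ X0 `<=` X) \/ X = set0].
have [|A [PA Amax]] := @Zorn_bigcup T P'.
  move=> F FP Ftot.
  have [[X [FX [x Xx]]]|F0] := pselect (exists X, F X /\ X !=set0).
    left; have PX : P X /\ X0 `<=` X by case: (FP _ FX) => // X_0; rewrite X_0 in Xx.
    pose F' := F `&` P `&` [set X | X0 `<=` X].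
    have -> : \bigcup_(X in F) X = \bigcup_(X in F') X.
      apply/seteqP; split=> y [Y FY Yy]; exists Y => //; last by case: FY => -[].
      by case: (FP _ FY) => [[? ?]|Y0] //; rewrite Y0 in Yy.
    split; last by move=> y X0y; exists X; [case: PX|apply: PX.2].
    apply: chain.
    - by move=> Y [[_ PY] _].
    - by exists X; case: PX => ? ?; do !split.
    - by move=> Y Z [[FY _] _] [[FZ _] _]; apply: Ftot.
  right; apply/seteqP; split=> // y [Y FY Yy]; apply: F0.
  by exists Y; split=> //; exists y.
have PA' : P A /\ X0 `<=` A.
  case: PA => // A0; have [X00|X0n] := pselect (X0 = set0).
    by rewrite A0 -X00; split.
  exfalso; apply: (Amax X0); last by left; split.
  by rewrite A0; split=> // X0s; apply: X0n; apply/seteqP; split.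
exists A; split; [by case: PA'|by case: PA'|move=> B AB PB].
apply/seteqP; split=> //; apply: contrapT => nBA.
by apply: (Amax B) => //; left; split=> //; apply: subset_trans AB; case: PA'.
Qed.

Section FiniteIntersections.
Variable T : Type.
Implicit Types (F G : set (set T)) (L M : set T).

(** [finI F L]: L is an intersection of finitely many members of F; the empty
    intersection is the whole type. *)
Inductive finI F : set T -> Prop :=
| finI_T : finI F setT
| finI_cons L M : finI F L -> F M -> finI F (L `&` M).

Lemma finI_mono F G L : F `<=` G -> finI F L -> finI G L.
Proof.
move=> FG; elim=> [|{}L M _ IH FM]; first exact: finI_T.
by apply: finI_cons => //; apply: FG.
Qed.

Lemma finI_mem F M : F M -> finI F M.
Proof. by move=> FM; rewrite -[M]setTI; apply: finI_cons => //; apply: finI_T. Qed.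

Lemma finI_cap F L L' : finI F L -> finI F L' -> finI F (L `&` L').
Proof.
move=> FL; elim=> [|{}L' M _ IH FM]; first by rewrite setIT.
by rewrite setIA; apply: finI_cons.
Qed.

Lemma bigcap_sub_finI F L : finI F L -> \bigcap_(M in F) M `<=` L.
Proof.
by elim=> [|{}L M _ IH FM] x // Fx; split; [apply: IH|apply: Fx].
Qed.

Lemma finI_add F C L : finI (F `|` [set C]) L ->
  exists2 L', finI F L' & L' `&` C `<=` L.
Proof.
elim=> [|{}L M _ [L' FL' sL]]; first by exists setT => //; apply: finI_T.
case=> [FM|->].
  exists (L' `&` M); first exact: finI_cons.
  by move=> x [[L'x Mx] Cx]; split=> //; apply: sL.
by exists L' => // x [L'x Cx]; split=> //; apply: sL.
Qed.

Lemma finI_bigcup (H : set (set (set T))) L : H !=set0 -> total_on H subset ->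
  finI (\bigcup_(F in H) F) L -> exists2 F, H F & finI F L.
Proof.
move=> [F0 HF0] tot; elim=> [|{}L M _ [F HF FL] [G HG GM]].
  by exists F0 => //; apply: finI_T.
have [FG|GF] := tot _ _ HF HG.
  by exists G => //; apply: finI_cons => //; apply: finI_mono FL.
by exists F => //; apply: finI_cons => //; apply: GF.
Qed.

End FiniteIntersections.

(** * Left ideals and the Jacobson radical of a ring *)

Section LeftIdeals.
Variable R : pzRingType.
Implicit Types (L M X : set R).

(** Left ideals of a ring without topology, as sets. *)
Definition lideal L : Prop :=
  [/\ L 0, forall x y, L x -> L y -> L (x + y) & forall a x, L x -> L (a * x)].

(** Maximal elements among the proper sets satisfying P. *)
Definition maximal_among (T : Type) (P : set T -> Prop) : set (set T) :=
  [set I | [/\ P I, I <> setT & forall J, P J -> J <> setT -> I `<=` J -> J = I]].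

Definition linvertible (x : R) := exists y, y * x = 1.

Lemma lideal0 L : lideal L -> L 0. Proof. by case. Qed.
Lemma lidealD L x y : lideal L -> L x -> L y -> L (x + y).
Proof. by case=> _ + _; apply. Qed.
Lemma lidealM L a x : lideal L -> L x -> L (a * x).
Proof. by case=> _ _; apply. Qed.
Lemma lidealN L x : lideal L -> L x -> L (- x).
Proof. by move=> hL Lx; rewrite -mulN1r; apply: lidealM. Qed.
Lemma lidealB L x y : lideal L -> L x -> L y -> L (x - y).
Proof. by move=> hL Lx Ly; apply: lidealD => //; apply: lidealN. Qed.

Lemma lideal_transl L x y : lideal L -> L (x - y) -> L y -> L x.
Proof. by move=> hL Lxy Ly; rewrite -(subrK y x); apply: lidealD. Qed.

Lemma lideal_sym L x y : lideal L -> L (x - y) -> L (y - x).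
Proof. by move=> hL /lidealN; rewrite opprB; apply. Qed.

Lemma lideal_trans L x y z : lideal L -> L (x - y) -> L (y - z) -> L (x - z).
Proof. by move=> hL h1 h2; have := lidealD hL h1 h2; rewrite subrKA. Qed.

Lemma lideal1 L : lideal L -> L 1 -> L = setT.
Proof.
by move=> hL L1; apply/seteqP; split=> // x _; rewrite -[x]mulr1; apply: lidealM.
Qed.

Lemma lidealT : lideal (@setT R). Proof. by []. Qed.

Lemma lidealI L M : lideal L -> lideal M -> lideal (L `&` M).
Proof.
move=> hL hM; split; first by split; apply: lideal0.
  by move=> x y [? ?] [? ?]; split; apply: lidealD.
by move=> a x [? ?]; split; apply: lidealM.
Qed.

Lemma lideal_bigcap (F : set (set R)) :
  F `<=` lideal -> lideal (\bigcap_(L in F) L).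
Proof.
move=> hF; split; first by move=> L FL; have hL := hF _ FL; exact: (lideal0 hL).
  move=> x y hx hy L FL; have hL := hF _ FL.
  by apply: (lidealD hL); [exact: hx|exact: hy].
by move=> a x hx L FL; have hL := hF _ FL; apply: (lidealM _ hL); exact: hx.
Qed.

(** The sum L + M; when M is an ideal it is the union of the M-cosets meeting L. *)
Definition sum_set L M : set R := [set z | exists2 x, L x & M (z - x)].

Lemma lideal_sum L M : lideal L -> lideal M -> lideal (sum_set L M).
Proof.
move=> hL hM; split; first by exists 0; [|rewrite subr0]; apply: lideal0.
  move=> x y [u Lu Mu] [v Lv Mv]; exists (u + v); first exact: lidealD.
  by rewrite opprD addrACA; apply: lidealD.
move=> a x [u Lu Mu]; exists (a * u); first exact: lidealM.
by rewrite -mulrBr; apply: lidealM.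
Qed.

Lemma sub_suml L M : lideal M -> L `<=` sum_set L M.
Proof. by move=> hM x Lx; exists x => //; rewrite subrr; apply: lideal0. Qed.

Lemma sub_sumr L M : lideal L -> M `<=` sum_set L M.
Proof. by move=> hL x Mx; exists 0; [apply: lideal0|rewrite subr0]. Qed.

Lemma sum_sub L M N : lideal N -> L `<=` N -> M `<=` N -> sum_set L M `<=` N.
Proof.
by move=> hN LN MN z [x /LN Nx /MN Nzx]; apply: lideal_transl Nzx Nx.
Qed.

Definition principal (x : R) : set R := [set a * x | a in setT].

Lemma lideal_principal x : lideal (principal x).
Proof.
split; first by exists 0; rewrite ?mul0r.
  by move=> _ _ [a _ <-] [b _ <-]; exists (a + b); rewrite ?mulrDl.
by move=> b _ [a _ <-]; exists (b * a); rewrite ?mulrA.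
Qed.

Lemma principal_id x : principal x x. Proof. by exists 1; rewrite ?mul1r. Qed.

Notation maximal := (maximal_among lideal).

Lemma maximal1 M : maximal M -> ~ M 1.
Proof. by case=> hM MT _ /(lideal1 hM)/MT. Qed.

Lemma ex_maximal L : lideal L -> ~ L 1 -> exists2 M, maximal M & L `<=` M.
Proof.
move=> hL L1.
have [//||M [[hM M1] LM Mmax]] := @zorn_above R (fun X => lideal X /\ ~ X 1) L.
  move=> F FP [X FX] tot; split; last by case=> Y /FP[].
  have hF Y : F Y -> lideal Y by move=> /FP[].
  split; first by exists X => //; apply: (lideal0 (hF _ FX)).
    move=> x y [Y FY Yx] [Z FZ Zy]; have [YZ|ZY] := tot _ _ FY FZ.
      by exists Z => //; apply: (lidealD (hF _ FZ)) => //; apply: YZ.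
    by exists Y => //; apply: (lidealD (hF _ FY)) => //; apply: ZY.
  by move=> a x [Y FY Yx]; exists Y => //; apply: (lidealM _ (hF _ FY)).
exists M => //; split=> //; first by move=> MT; apply: M1; rewrite MT.
move=> N hN NT MN; apply: Mmax => //; split=> // N1.
by apply: NT; apply: lideal1.
Qed.

Lemma maximal_sum M L : maximal M -> lideal L -> ~ L `<=` M -> sum_set L M = setT.
Proof.
move=> [hM MT Mmax] hL nLM; apply: contrapT => sT; apply: nLM.
have <- : sum_set L M = M.
  by apply: Mmax => //; [apply: lideal_sum|apply: sub_sumr].
exact: sub_suml.
Qed.

(** A nonzero element of the simple module R / M generates it. *)
Lemma maximal_elt M x : maximal M -> ~ M x -> exists y, M (1 - y * x).
Proof.
move=> mM nMx.
have : sum_set (principal x) M 1.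
  rewrite (maximal_sum mM) //; first exact: lideal_principal.
  by move=> /(_ _ (principal_id x)).
by case=> _ [y _ <-]; exists y.
Qed.

(** If w is a left inverse of 1 - b a, then 1 + a w b is one of 1 - a b. *)
Lemma linvertible_comm (a b : R) :
  linvertible (1 - b * a) -> linvertible (1 - a * b).
Proof.
move=> [w hw]; exists (1 + a * w * b).
have -> : (1 + a * w * b) * (1 - a * b) = 1 - a * b + a * (w * (1 - b * a)) * b.
  rewrite mulrDl mul1r; congr (_ + _).
  by rewrite !mulrBr !mulrBl !mulr1 !mulrA.
by rewrite hw mulr1 subrK.
Qed.

(** The Jacobson radical, defined by left quasi-regularity.  The other
    characterizations are proved to agree with it. *)
Definition jacobson : set R := [set x | forall y, linvertible (1 - y * x)].

Lemma jacobson_maximal : jacobson = \bigcap_(M in maximal) M.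
Proof.
apply/seteqP; split=> [x qx M mM|x hx y].
  apply: contrapT => nMx; have [y My] := maximal_elt mM nMx.
  have [w hw] := qx y; apply: (maximal1 mM); rewrite -hw.
  by apply: lidealM => //; case: mM.
apply: contrapT => ninv.
have [||M mM hM] := @ex_maximal (principal (1 - y * x)).
- exact: lideal_principal.
- by move=> [w _ hw]; apply: ninv; exists w.
apply: (maximal1 mM); have hMi : lideal M by case: mM.
apply: (@lideal_transl M 1 (y * x)) => //; first exact/hM/principal_id.
by apply: lidealM => //; apply: hx.
Qed.

Lemma lideal_jacobson : lideal jacobson.
Proof. by rewrite jacobson_maximal; apply: lideal_bigcap => M []. Qed.

Lemma jacobson_right x z : jacobson x -> jacobson (x * z).
Proof.
by move=> qx y; rewrite mulrA; apply: linvertible_comm; rewrite mulrA; apply: qx.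
Qed.

(** A left inverse w of 1 - x equals 1 + w x, with w x again in the radical, so w is
    itself left invertible and thus a two-sided inverse. *)
Lemma jacobson_inv x :
  jacobson x -> exists y, y * (1 - x) = 1 /\ (1 - x) * y = 1.
Proof.
move=> qx; have := qx 1; rewrite mul1r => -[w hw].
have wE : w = 1 + w * x.
  by rewrite -[in RHS]hw mulrBr mulr1 subrK.
have [v hv] := qx (- w); rewrite mulNr opprK -wE in hv.
have xE : 1 - x = v by rewrite -[LHS]mul1r -{1}hv -mulrA hw mulr1.
by exists w; split=> //; rewrite xE.
Qed.

(** The left-right symmetric description of the radical. *)
Lemma jacobsonE : jacobson = [set x | forall y z, exists w,
  w * (1 - y * x * z) = 1 /\ (1 - y * x * z) * w = 1].
Proof.
apply/seteqP; split=> [x qx y z|x hx y].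
  apply: jacobson_inv; rewrite -mulrA; apply: (lidealM _ lideal_jacobson).
  exact: jacobson_right.
by have [w [hw _]] := hx y 1; rewrite mulr1 in hw; exists w.
Qed.

End LeftIdeals.

(** The radical of the opposite ring is the radical. *)
Lemma jacobson_conv (R : pzRingType) : @jacobson R^c = @jacobson R.
Proof.
rewrite !jacobsonE; apply/seteqP; split=> x h y z; have [w [h1 h2]] := h z y.
  by exists w; split; rewrite -mulrA; [exact: h2|exact: h1].
by exists w; split; [move: h2|move: h1]; rewrite -mulrA.
Qed.

(** * Non-generators *)

Section NonGenerators.
Variables (T : Type) (P : set T -> Prop).
Hypothesis Pcap : forall F : set (set T), F `<=` P -> P (\bigcap_(L in F) L).
Hypothesis Pmax : forall L, P L -> L <> setT ->
  exists2 M, maximal_among P M & L `<=` M.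

(** Non-generators for an abstract closure system P in which every proper closed
    set lies in a maximal one; it serves for left ideals and for closed left ideals. *)
Lemma bigcap_maximal_nongenerator :
  \bigcap_(M in maximal_among P) M = [set a | forall X,
    smallest P (X `|` [set a]) = setT -> smallest P X = setT].
Proof.
have Psm X : P (smallest P X) by apply: Pcap => L [].
apply/seteqP; split=> [a ha X XaT|a ha M mM].
  apply: contrapT => XT; have [M mM XM] := Pmax (Psm X) XT.
  case: (mM) => PM MT _; apply: MT; apply/seteqP; split=> //.
  rewrite -XaT; apply: smallest_sub => // x [Xx|->]; last exact: ha.
  by apply: XM; apply: sub_gen_smallest.
apply: contrapT => nMa; case: (mM) => PM MT Mmax; apply: (MT).
rewrite -(smallest_id PM); apply: ha; apply: contrapT => ST.
apply: nMa; rewrite -(Mmax (smallest P (M `|` [set a]))) //.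
  by apply: sub_gen_smallest; right.
by move=> x Mx; apply: sub_gen_smallest; left.
Qed.

End NonGenerators.

(** * Two-sided ideals and their products *)

Section TwoSided.
Variable R : pzRingType.
Implicit Types (L M X : set R).

(** Right ideals. *)
Definition rideal L : Prop :=
  [/\ L 0, forall x y, L x -> L y -> L (x + y) & forall a x, L x -> L (x * a)].

(** Two-sided ideals. *)
Definition tideal L : Prop := lideal L /\ rideal L.

Lemma tideal_left L : tideal L -> lideal L. Proof. by case. Qed.
Lemma tidealM L a x : tideal L -> L x -> L (x * a).
Proof. by case=> _ [_ _]; apply. Qed.

Lemma mk_tideal L : lideal L -> (forall a x, L x -> L (x * a)) -> tideal L.
Proof. by move=> hL hr; split=> //; split=> //; case: hL. Qed.

Lemma tideal_jacobson : tideal (@jacobson R).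
Proof.
apply: mk_tideal; first exact: lideal_jacobson.
by move=> a x; apply: jacobson_right.
Qed.

Lemma tideal_sum L M : tideal L -> tideal M -> tideal (sum_set L M).
Proof.
move=> hL hM; apply: mk_tideal; first exact: lideal_sum (tideal_left hL) (tideal_left hM).
move=> a x [u Lu Mu]; exists (u * a); first exact: tidealM.
by rewrite -mulrBl; apply: tidealM.
Qed.

(** The abstract product of two ideals: finite sums of products. *)
Definition iprod L M : set R :=
  [set x | exists (n : nat) (u v : 'I_n -> R),
     (forall i, L (u i) /\ M (v i)) /\ x = \sum_(i < n) u i * v i].

Lemma iprod_mem L M x y : L x -> M y -> iprod L M (x * y).
Proof.
move=> Lx My; exists 1%N, (fun=> x), (fun=> y); split=> //.
by rewrite big_ord1.
Qed.

Lemma tideal_iprod L M : tideal L -> tideal M -> tideal (iprod L M).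
Proof.
move=> hL hM; apply: mk_tideal; first split.
- exists 0%N, (fun=> 0), (fun=> 0); rewrite big_ord0; split=> // i.
  by split; apply: lideal0; apply: tideal_left.
- move=> _ _ [n [u [v [uv ->]]]] [m [u' [v' [uv' ->]]]].
  exists (n + m)%N,
    (fun i : 'I_(n + m) => match fintype.split i with inl j => u j | inr j => u' j end),
    (fun i : 'I_(n + m) => match fintype.split i with inl j => v j | inr j => v' j end).
  split.
    by move=> i; case: (fintype.split i).
  rewrite big_split_ord /=; congr (_ + _); apply: eq_bigr => i _.
    by rewrite (unsplitK (inl i)).
  by rewrite (unsplitK (inr i)).
- move=> a _ [n [u [v [uv ->]]]]; exists n, (fun i => a * u i), v; split.
    by move=> i; have [Lu Mv] := uv i; split=> //; apply: (lidealM _ (tideal_left hL)).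
  by rewrite mulr_sumr; apply: eq_bigr => i _; rewrite mulrA.
- move=> a _ [n [u [v [uv ->]]]]; exists n, u, (fun i => v i * a); split.
    by move=> i; have [Lu Mv] := uv i; split=> //; apply: tidealM.
  by rewrite mulr_suml; apply: eq_bigr => i _; rewrite mulrA.
Qed.

Lemma iprod_sub L M N : lideal N -> (forall x y, L x -> M y -> N (x * y)) ->
  iprod L M `<=` N.
Proof.
move=> hN h _ [n [u [v [uv ->]]]].
elim/big_rec: _ => [|i x _ Nx]; first exact: lideal0.
by apply: lidealD => //; have [? ?] := uv i; apply: h.
Qed.

End TwoSided.

(** * Rings complete for a filter base of two-sided ideals *)

Section Base.
Variables (R : pzRingType) (I : Type) (K : I -> set R).

(** A filter base of two-sided ideals for a complete Hausdorff linear topology on R.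
    Completeness is stated for families a_i that are compatible modulo the K_i. *)
Record pseudocompact_base : Prop := PseudocompactBase {
  base_left : forall i, lideal (K i);
  base_right : forall i a x, K i x -> K i (x * a);
  base_inh : inhabited I;
  base_dir : forall i j, exists l, K l `<=` K i /\ K l `<=` K j;
  base_sep : forall x, (forall i, K i x) -> x = 0;
  base_complete : forall a : I -> R,
    (forall i j, K j `<=` K i -> K i (a j - a i)) ->
    exists x, forall i, K i (x - a i) }.

(** The closure of C in the topology with neighbourhood base x + K_i. *)
Definition bclosure (C : set R) : set R :=
  [set x | forall i, exists2 c, C c & K i (x - c)].
(** Closed sets of that topology. *)
Definition bclosed C := bclosure C `<=` C.
(** For a left ideal L, this says that L is open. *)
Definition bopen L := exists i, K i `<=` L.
(** Open maximal left ideals. *)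
Definition open_maximal : set (set R) := [set M | maximal_among (@lideal R) M /\ bopen M].
Definition closed_lideal L := bclosed L /\ lideal L.
Definition closed_tideal L := bclosed L /\ tideal L.

(** Each R / K_i is left artinian: every nonempty family of left ideals containing
    K_i has a minimal member. *)
Definition artinian := forall i (F : set (set R)), F !=set0 ->
  (forall L, F L -> lideal L /\ K i `<=` L) ->
  exists2 L, F L & forall L', F L' -> L' `<=` L -> L `<=` L'.

(** [bpower L n] is the closed power L^(n+1). *)
Fixpoint bpower L (n : nat) : set R :=
  if n is m.+1 then bclosure (iprod (bpower L m) L) else L.

Hypothesis hK : pseudocompact_base.

Let Kl := base_left hK.

Lemma tidealK i : tideal (K i).
Proof. by apply: mk_tideal => // a x; apply: base_right. Qed.

Lemma sub_bclosure C : C `<=` bclosure C.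
Proof. by move=> x Cx i; exists x => //; rewrite subrr; apply: lideal0. Qed.

Lemma bclosed_bclosure C : bclosed (bclosure C).
Proof.
move=> x hx i; have [y /(_ i)[z Cz yz] xy] := hx i; exists z => //.
exact: lideal_trans yz.
Qed.

Lemma bclosure_sub C D : bclosed D -> C `<=` D -> bclosure C `<=` D.
Proof. by move=> hD CD x hx; apply: hD => i; have [c /CD] := hx i; exists c. Qed.

Lemma lideal_bclosure L : lideal L -> lideal (bclosure L).
Proof.
move=> hL; split; first by apply: sub_bclosure; apply: lideal0.
  move=> x y hx hy i; have [c Lc xc] := hx i; have [d Ld yd] := hy i.
  exists (c + d); first exact: lidealD.
  by rewrite opprD addrACA; apply: lidealD.
move=> a x hx i; have [c Lc xc] := hx i; exists (a * c); first exact: lidealM.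
by rewrite -mulrBr; apply: lidealM.
Qed.

Lemma tideal_bclosure L : tideal L -> tideal (bclosure L).
Proof.
move=> hL; apply: mk_tideal; first exact: lideal_bclosure (tideal_left hL).
move=> a x hx i; have [c Lc xc] := hx i; exists (c * a); first exact: tidealM.
by rewrite -mulrBl; apply: base_right.
Qed.

Lemma bopen_closed L : lideal L -> bopen L -> bclosed L.
Proof.
move=> hL [i KL] x /(_ i)[c Lc /KL Lxc]; exact: lideal_transl Lxc Lc.
Qed.

Lemma bclosed_bigcap (F : set (set R)) :
  F `<=` bclosed -> bclosed (\bigcap_(L in F) L).
Proof.
move=> hF x hx L FL; apply: (hF _ FL) => i; have [c Fc xc] := hx i.
by exists c => //; apply: Fc.
Qed.

(** A closed set missing 1 misses a neighbourhood of 1. *)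
Lemma closed_proper_open C : bclosed C -> ~ C 1 ->
  exists i, ~ sum_set C (K i) 1.
Proof.
move=> cC C1; apply: contrapT => h; apply: C1; apply: cC => i.
by apply: contrapT => hi; apply: h; exists i => -[c Cc Kc]; apply: hi; exists c.
Qed.

Lemma ex_open_maximal L : closed_lideal L -> ~ L 1 -> exists2 M, open_maximal M & L `<=` M.
Proof.
move=> [cL hL] L1; have [i Li1] := closed_proper_open cL L1.
have [|M mM LM] := ex_maximal _ Li1; first exact: lideal_sum.
exists M; last by move=> x Lx; apply: LM; apply: sub_suml.
by split=> //; exists i => x Kx; apply: LM; apply: sub_sumr.
Qed.

(** The maximal closed left ideals are the open maximal left ideals. *)
Lemma open_maximalE : open_maximal = maximal_among closed_lideal.
Proof.
apply/seteqP; split=> [M [mM oM]|M [[cM hM] MT Mmax]].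
  case: mM => hM MT Mmax; split=> //; first by split=> //; apply: bopen_closed.
  by move=> L [_]; apply: Mmax.
have [||M' mM' MM'] := @ex_open_maximal M; [by split|by move/(lideal1 hM)|].
suff -> : M = M' by [].
case: (mM') => -[hM' MT' _] oM'; apply/esym/Mmax => //.
by split=> //; apply: bopen_closed.
Qed.

(** The inverse of 1 - z, for z in all open maximal left ideals, is obtained by gluing
    its inverses modulo the K_i. *)
Lemma jacobson_open_maximal : @jacobson R = \bigcap_(M in open_maximal) M.
Proof.
apply/seteqP; split=> [x|x hx y].
  by rewrite jacobson_maximal => hx M [mM _]; apply: hx.
have hJ : lideal (\bigcap_(M in open_maximal) M) by apply: lideal_bigcap => M [[]].
move: {x y hx} (y * x) (lidealM y hJ hx) => z hz.
(* Otherwise R (1 - z') + K_i lies in a maximal left ideal, which is open. *)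
have linvK z' i : (\bigcap_(M in open_maximal) M) z' -> exists w, K i (1 - w * (1 - z')).
  move=> hz'; suff [_ [w _ <-] hw] : sum_set (principal (1 - z')) (K i) 1 by exists w.
  apply: contrapT => n1.
  have [|M mM PM] := ex_maximal _ n1.
    by apply: lideal_sum => //; apply: lideal_principal.
  have hM : lideal M by case: mM.
  apply: (maximal1 mM); apply: (@lideal_transl _ M 1 z') => //.
    by apply: PM; apply: sub_suml => //; apply: principal_id.
  apply: hz'; split=> //; exists i => x Kx; apply: PM; apply: sub_sumr => //.
  exact: lideal_principal.
(* A left inverse w of 1 - z modulo K_i is 1 + w z, so it has a left inverse v,
     and v = v w (1 - z) = 1 - z modulo K_i. *)
have rinvK w i : K i (1 - w * (1 - z)) -> K i (1 - (1 - z) * w).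
  move=> hw; have [|v hv] := linvK (- w * z) i; first exact: (lidealM _ hJ).
  rewrite mulNr opprK in hv.
  have vw : K i (1 - v * w).
    apply: (lideal_trans (Kl i) hv); rewrite -mulrBr; apply: (lidealM _ (Kl i)).
    by rewrite mulrBr mulr1 opprB addrA in hw.
  have zv : K i (v - (1 - z)).
    apply: (@lideal_trans _ _ _ (v * w * (1 - z))) => //.
      rewrite -[X in K i (X - _)]mulr1 -mulrA -mulrBr; exact: (lidealM _ (Kl i)).
    apply: lideal_sym => //; rewrite -[X in K i (X - _)]mul1r -mulrBl.
    exact: base_right.
  by apply: (lideal_trans (Kl i) vw); rewrite -mulrBl; apply: base_right.
have [w hw] := boolp.choice (fun i => linvK z i hz).
(* Left inverses modulo K_i are unique: w_j = w_j (1 - z) w_i = w_i modulo K_i as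
   soon as K_j is contained in K_i. *)
have [|W hW] := base_complete hK (a := w).
  move=> i j ji; apply: (@lideal_trans _ _ _ (w j * ((1 - z) * w i))) => //.
    by rewrite -[X in K i (X - _)]mulr1 -mulrBr; apply: (lidealM _ (Kl i)); apply: rinvK.
  apply: lideal_sym => //; rewrite mulrA -[X in K i (X - _)]mul1r -mulrBl.
  exact/base_right/ji.
exists W; apply/eqP; rewrite eq_sym -subr_eq0; apply/eqP/(base_sep hK) => i.
apply: (lideal_trans (Kl i) (hw i)); rewrite -mulrBl; apply: base_right => //.
exact: lideal_sym.
Qed.

Lemma bclosed_jacobson : bclosed (@jacobson R).
Proof.
rewrite jacobson_open_maximal; apply: bclosed_bigcap => M [[hM _ _] oM].
exact: bopen_closed.
Qed.

Hypothesis hart : artinian.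

(** A maximal closed two-sided ideal N is open.  If N did not contain the radical,
    their sum would be R, and N would contain an invertible 1 - j. *)
Lemma jacobson_sub_twosided N :
  maximal_among closed_tideal N -> @jacobson R `<=` N.
Proof.
move=> [[cN tN] NT Nmax]; have hN := tideal_left tN.
have N1 : ~ N 1 by move/(lideal1 hN)/NT.
have [i Ni1] := closed_proper_open cN N1.
have tNi : tideal (sum_set N (K i)) by apply: tideal_sum => //; apply: tidealK.
have KN : K i `<=` N.
  rewrite -(Nmax (sum_set N (K i))).
  - exact: sub_sumr.
  - split=> //; apply: bopen_closed; first exact: tideal_left.
    by exists i; apply: sub_sumr.
  - by move=> sT; apply: Ni1; rewrite sT.
  - exact: sub_suml.
move=> x qx; apply: contrapT => nNx.
have tS : tideal (sum_set (@jacobson R) N) by apply: tideal_sum => //; apply: tideal_jacobson.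
have [j qj Nj] : sum_set (@jacobson R) N 1.
  apply: contrapT => n1; apply: nNx; rewrite -(Nmax (sum_set (@jacobson R) N)).
  - exact: sub_suml.
  - split=> //; apply: bopen_closed; first exact: tideal_left.
    by exists i => y Ky; apply: sub_sumr; [exact: lideal_jacobson|exact: KN].
  - by move=> sT; apply: n1; rewrite sT.
  - by apply: sub_sumr; exact: lideal_jacobson.
by have [w [hw _]] := jacobson_inv qj; apply: N1; rewrite -hw; apply: lidealM.
Qed.

(** The annihilator P of R / M is maximal among the closed two-sided ideals. *)
Lemma open_maximal_ann M : open_maximal M ->
  maximal_among closed_tideal [set a | forall b, M (a * b)].
Proof.
move=> [mM [i KM]]; have hM : lideal M by case: mM.
set P := [set a | _].
have hP : lideal P.
  split; first by move=> b; rewrite mul0r; apply: lideal0.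
    by move=> x y hx hy b; rewrite mulrDl; apply: lidealD.
  by move=> a x hx b; rewrite -mulrA; apply: lidealM.
have tP : tideal P by apply: mk_tideal => // a x hx b; rewrite -mulrA.
have KP : K i `<=` P by move=> x Kx b; apply/KM/base_right.
split.
- by split=> //; apply: bopen_closed => //; exists i.
- by move=> PT; apply: (maximal1 mM); rewrite -[1]mulr1; have : P 1 by rewrite PT.
move=> Q [_ tQ] QT PQ; apply/seteqP; split=> //.
have hQ := tideal_left tQ.
(* A minimal left ideal C containing P with Q + C = R is a complement of Q. *)
pose G := [set C | [/\ lideal C, P `<=` C & sum_set Q C = setT]].
have [||C [hC PC QC] Cmin] := @hart i G.
- exists setT; split=> //; apply/seteqP; split=> // x _; exact: sub_sumr.
- by move=> L [hL PL _]; split=> //; apply: subset_trans PL.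
(* P is the intersection of the maximal left ideals N = ann(b mod M).  If z in Q and C
     avoids one of them, then C is contained in R z + (C meet N), so that
     Q + (C meet N) = R, against minimality. *)
have QCP : Q `&` C `<=` P.
  move=> z [Qz Cz] b; apply: contrapT => nM; apply: (nM).
  have [y My] := maximal_elt mM nM.
  pose N := [set a | M (a * b)].
  have hN : lideal N.
    split; first by rewrite /N /= mul0r; apply: lideal0.
      by move=> u v hu hv; rewrite /N /= mulrDl; apply: lidealD.
    by move=> a u hu; rewrite /N /= -mulrA; apply: lidealM.
  suff CN : C `<=` C `&` N by case: (CN z Cz).
  apply: Cmin; last by move=> ? [].
  split; [exact: lidealI|by move=> x Px; split; [exact: PC|exact: Px]|].
  apply/seteqP; split=> // t _.
  have [q Qq Ctq] : sum_set Q C t by rewrite QC.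
  exists (q + (t - q) * b * y * z).
    by apply: lidealD => //; apply: lidealM.
  rewrite opprD addrA; move: (t - q) Ctq => d Cd.
  split; first by apply: lidealB => //; apply: (lidealM _ hC).
  rewrite /N /= mulrBl -!mulrA -mulrBr; apply: (lidealM _ hM).
  by rewrite -[X in M (X - _)]mulr1 -mulrBr; apply: (lidealM _ hM).
(* If C kills R / M, then Q + P = R; otherwise C (R / M) = R / M, and then
     Q (R / M) = Q C (R / M) = 0. *)
have [CP|nCP] := pselect (C `<=` P).
  exfalso; apply: QT; apply/seteqP; split=> // x _.
  suff : sum_set Q C x by apply: sum_sub => // y Cy; apply/PQ/CP.
  by rewrite QC.
have [c [b0 [Cc nM]]] : exists c b0, C c /\ ~ M (c * b0).
  apply: contrapT => h; apply: nCP => c Cc b0; apply: contrapT => nM.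
  by apply: h; exists c, b0.
have [y My] := maximal_elt mM nM.
move=> q Qq b.
apply: (@lideal_transl _ M _ (q * (b * y * c) * b0)) => //.
  rewrite -mulrA -mulrBr; apply: lidealM => //.
  by rewrite -[X in M (X - _)]mulr1 -!mulrA -mulrBr; apply: lidealM => //.
by apply: QCP; split; [exact: tidealM|do !apply: lidealM].
Qed.

Lemma jacobson_twosided : @jacobson R = \bigcap_(N in maximal_among closed_tideal) N.
Proof.
apply/seteqP; split=> [x qx N mN|x hx]; first exact: jacobson_sub_twosided mN _ qx.
rewrite jacobson_open_maximal => M mM; rewrite -[x]mulr1.
exact: (hx _ (open_maximal_ann mM)).
Qed.

End Base.

(** * Linear compactness *)

Section Compactness.
Variables (R : pzRingType) (I : Type) (K : I -> set R).
Hypotheses (hK : pseudocompact_base K) (hart : artinian K).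
Implicit Types (C L M : set R) (F : set (set R)).

Let Kl := base_left hK.

(** Empty sets and cosets of left ideals; this form is stable under intersection. *)
Definition affine C := forall a x y z, C x -> C y -> C z -> C (x + a * (y - z)).

(** The coset d + L. *)
Definition coset L d : set R := [set x | L (x - d)].

Lemma affine_coset L d : lideal L -> affine (coset L d).
Proof.
move=> hL a x y z Lx Ly Lz; rewrite /coset /= addrAC; apply: lidealD => //.
by apply: lidealM => //; apply: (lideal_trans hL Ly); apply: lideal_sym.
Qed.

Lemma affine_lideal L : lideal L -> affine L.
Proof.
by move=> hL a x y z Lx Ly Lz; apply: lidealD => //; apply: lidealM => //; apply: lidealB.
Qed.

Lemma affine_finI F L : F `<=` affine -> finI F L -> affine L.
Proof.
move=> hF; elim=> [//|{}L M _ IH /hF hM] a x y z [? ?] [? ?] [? ?].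
by split; [apply: IH|apply: hM].
Qed.

(** The finite intersection property. *)
Definition FIP F := forall C, finI F C -> C !=set0.

(** A coset of K_i can be added to F: since R / K_i is artinian, the images in R / K_i
    of the finite intersections of F have a least one, and any of its points will do. *)
Lemma FIP_coset F i : F `<=` affine -> FIP F ->
  exists d, FIP (F `|` [set coset (K i) d]).
Proof.
move=> aF fF; pose dirn C y := [set v | exists2 l, C l & K i (v - (l - y))].
have dirn_lideal C y : affine C -> C y -> lideal (dirn C y).
  move=> aC Cy; split; first by exists y => //; rewrite !subrr; apply: lideal0.
    move=> u v [l Cl ul] [m Cm vm]; exists (l + 1 * (m - y)); first exact: aC.
    by rewrite mul1r (addrAC l) opprD addrACA; apply: lidealD.
  move=> a u [l Cl ul]; exists (y + a * (l - y)); first exact: aC.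
  by rewrite addrAC subrr add0r -mulrBr; apply: lidealM.
pose G := [set V | exists C y, [/\ finI F C, C y & V = dirn C y]].
have [||_ [C0 [y0 [FC0 C0y ->]]] Gmin] := @hart i G.
- by exists (dirn setT 0), setT, 0; split=> //; apply: finI_T.
- move=> _ [C [y [FC Cy ->]]]; split.
    by apply: dirn_lideal => //; apply: affine_finI FC.
  by move=> v Kv; exists y => //; rewrite subrr subr0.
exists y0 => C /finI_add[C1 FC1 sub].
have FC2 : finI F (C1 `&` C0) by apply: finI_cap.
have [y1 [C1y C0y1]] := fF _ FC2.
have aC0 : affine C0 by apply: affine_finI FC0.
have s01 : dirn C0 y0 `<=` dirn (C1 `&` C0) y1.
  apply: Gmin; first by exists (C1 `&` C0), y1.
  move=> v [l [_ C0l] vl]; exists (y0 + 1 * (l - y1)); first exact: aC0.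
  by rewrite mul1r [y0 + _]addrC addrK.
have [|l [C1l _] Kl1] := s01 (y0 - y1).
  rewrite -opprB; apply: lidealN; first exact: dirn_lideal.
  by exists y1 => //; rewrite subrr; apply: lideal0.
exists l; apply: sub; split=> //; apply: lideal_sym => //.
by rewrite opprB addrA subrK in Kl1.
Qed.

Theorem linearly_compact F : F `<=` affine -> F `<=` bclosed K -> FIP F ->
  exists x, forall C, F C -> C x.
Proof.
move=> aF cF fF.
have [||G [[aG fG] FG Gmax]] := @zorn_above _ (fun G => G `<=` affine /\ FIP G) F.
- by [].
- move=> H HP [G0 HG0] tot; split; first by move=> C [G /HP[aG _] GC]; apply: aG.
  move=> C /finI_bigcup -/(_ _ tot)[|G HG]; first by exists G0.
  by case: (HP _ HG) => _; apply.
have Gcoset i : exists d, G (coset (K i) d).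
  have [d fd] := FIP_coset i aG fG; exists d.
  rewrite -(Gmax (G `|` [set coset (K i) d])); first by right.
    by move=> C GC; left.
  by split=> // C [/aG//|->]; apply: affine_coset.
have [d hd] := boolp.choice Gcoset.
have [|x hx] := base_complete hK (a := d).
  move=> i j ji.
  have [y [yi yj]] := fG _ (finI_cap (finI_mem (hd i)) (finI_mem (hd j))).
  apply: (@lideal_trans _ _ _ y) => //.
  by apply: lideal_sym => //; apply: ji.
exists x => C FC; apply: (cF _ FC) => i.
have [y [Cy yi]] := fG _ (finI_cap (finI_mem (FG _ FC)) (finI_mem (hd i))).
by exists y => //; apply: (lideal_trans (Kl i) (hx i)); apply: lideal_sym.
Qed.

Lemma bclosed_coset L d : lideal L -> bopen K L -> bclosed K (coset L d).
Proof.
by move=> hL [i KL] x /(_ i)[c Lc /KL xc]; apply: (lideal_trans hL xc).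
Qed.

(** Among the finite intersections of F choose L with L + K_i minimal.  For w in L the
    coset w + K_i meets all of them, hence their total intersection by linear
    compactness. *)
Lemma chevalley F i : F `<=` closed_lideal K ->
  exists2 L, finI F L & L `<=` sum_set (\bigcap_(M in F) M) (K i).
Proof.
move=> hF; pose G := [set V | exists2 L, finI F L & V = sum_set L (K i)].
have finI_lideal L : finI F L -> lideal L.
  elim=> [|{}L M _ hL /hF[_ hM]]; first exact: lidealT.
  exact: lidealI.
have [||_ [L FL ->] Gmin] := @hart i G.
- by exists (sum_set setT (K i)), setT => //; apply: finI_T.
- move=> _ [L /finI_lideal hL ->]; split; first exact: lideal_sum.
  exact: sub_sumr.
exists L => // w Lw.
have [|||x hx] := @linearly_compact (F `|` [set coset (K i) w]).
- by move=> C [/hF[_ /affine_lideal]//|->]; apply: affine_coset.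
- move=> C [/hF[]//|->]; apply: bclosed_coset => //; by exists i.
- move=> C /finI_add[C' FC' sub].
  have [|||c [C'c _] wc] := Gmin (sum_set (C' `&` L) (K i)) _ _ w.
  + by exists (C' `&` L) => //; apply: finI_cap.
  + by move=> v [l [_ Ll] vl]; exists l.
  + exact: sub_suml.
  by exists c; apply: sub; split=> //; apply: lideal_sym.
exists x; first by move=> M FM; apply: hx; left.
by apply: lideal_sym => //; apply: (hx (coset (K i) w)); right.
Qed.

(** * Independent families of open maximal left ideals *)

(** Families of open maximal left ideals in which no member contains a finite
    intersection of the others, so that R maps onto each finite product of the R / M. *)
Definition coindep F := F `<=` open_maximal K /\
  forall M, F M -> forall L, finI (F `\ M) L -> ~ L `<=` M.

(** If F is a maximal independent family, an exchange argument shows that each open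
    maximal left ideal contains a finite intersection of members of F. *)
Lemma ex_coindep : exists2 F, coindep F & \bigcap_(M in F) M = @jacobson R.
Proof.
have [||F [[Fm Fi] _ Fmax]] := @zorn_above _ coindep set0.
- by [].
- move=> H HP [F0 HF0] tot; split; first by move=> M [F /HP[aF _] FM]; apply: aF.
  move=> M [F HF FM] L.
  have -> : (\bigcup_(X in H) X) `\ M = \bigcup_(Y in [set X `\ M | X in H]) Y.
    apply/seteqP; split=> [N [[X HX XN] nM]|N [_ [X HX <-] [XN nM]]].
      by exists (X `\ M) => //; exists X.
    by split=> //; exists X.
  move=> /finI_bigcup[||_ [X HX <-] XL].
  + by exists (F0 `\ M), F0.
  + move=> _ _ [X HX <-] [Y HY <-]; have [XY|YX] := tot _ _ HX HY; [left|right];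
      by move=> N [? ?]; split=> //; auto.
  have [XF|FX] := tot _ _ HX HF.
    by apply: ((HP _ HF).2 _ FM); apply: finI_mono XL => N [? ?]; split=> //; apply: XF.
  by apply: ((HP _ HX).2 M) => //; apply: FX.
exists F => //; rewrite (jacobson_open_maximal hK); apply/seteqP; split; last first.
  by move=> x hx M /Fm; apply: hx.
move=> x hx M mM.
suff [L FL LM] : exists2 L, finI F L & L `<=` M by apply/LM/(bigcap_sub_finI FL).
have [FM|nFM] := pselect (F M); first by exists M => //; apply: finI_mem.
have hm N : open_maximal K N -> lideal N by case=> -[].
(* Adding M breaks independence.  Apart from the case where M itself contains a finite
     intersection of members of F, for some M' in F and some finite intersection L' of
     other members, L' meet M is contained in M' while L' is not.  As L' / (L' meet M) is
     simple, L' meet M = L' meet M', so L' meet M' is contained in M. *)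
have : ~ coindep (F `|` [set M]).
  by move=> /Fmax h; apply: nFM; rewrite -h; [right|move=> ? ?; left].
move=> /not_andP[h|].
  by case: h => N [/Fm//|->].
move=> /existsNP[M' /not_implyP[FM' /existsNP[L /not_implyP[FL /contrapT LM']]]].
have [M'M|nM'M] := pselect (M' = M).
  exists L; last by rewrite -M'M.
  by apply: finI_mono FL => N [[//|->]] nN; case: nN; rewrite M'M.
have FM'' : F M' by case: FM'.
have [|L' FL' sL'] := @finI_add _ (F `\ M') M L.
  by apply: finI_mono FL => N [[FN|->]] nN; [left|right].
exists (L' `&` M'); first by apply: finI_cons => //; apply: finI_mono FL' => N [].
move=> z [L'z M'z]; apply: contrapT => nMz.
have [y My] := maximal_elt mM.1 nMz.
have hL' : lideal L'.
  elim: FL' => [|{}A B _ hA [/Fm/hm hB _]]; first exact: lidealT.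
  exact: lidealI.
apply: (Fi _ FM'' _ FL') => l L'l.
have hM' := hm _ (Fm _ FM'').
apply: (@lideal_transl _ M' l (l * y * z)) => //; last exact: lidealM.
apply: LM'; apply: sL'; split; first by apply: lidealB => //; apply: lidealM.
rewrite -mulrA -[X in M (X - _)]mulr1 -mulrBr.
exact: (lidealM _ (hm _ mM)).
Qed.

(** The map from R to the product of the R / M, M in F, is surjective. *)
Lemma coindep_surj F (x : set R -> R) : coindep F ->
  exists y, forall M, F M -> M (y - x M).
Proof.
move=> [Fm Fi]; have hm N : F N -> lideal N by move=> /Fm [[]].
pose G := [set C | exists2 M, F M & C = coset M (x M)].
have [|||y hy] := @linearly_compact G.
- by move=> _ [M /hm hM ->]; apply: affine_coset.
- by move=> _ [M FM ->]; apply: bclosed_coset; [apply: hm|case: (Fm _ FM)].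
- move=> C GC.
  (* E collects the members of F that occur in the finite intersection C of cosets; L is
     their intersection, and C is a union of L-cosets. *)
  suff [E [L [y [EF EL EC LC Cy]]]] : exists E L y, [/\ E `<=` F, finI E L,
      forall M, E M -> C `<=` coset M (x M), forall c l, C c -> L l -> C (c + l) & C y].
    by exists y.
  elim: GC => [|{}C _ _ [E [L [y [EF EL EC LC Cy]]]] [M FM ->]].
    by exists set0, setT, 0; split=> //; apply: finI_T.
  have [EM|nEM] := pselect (E M).
    have -> : C `&` coset M (x M) = C.
      by apply/seteqP; split=> c; [case|move=> Cc; split=> //; apply: EC].
    by exists E, L, y.
  have hL : lideal L.
    elim: {EC LC} EL => [|{}A B _ hA /EF/hm hB]; first exact: lidealT.
    exact: lidealI.
  have nLM : ~ L `<=` M.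
    apply: Fi => //; apply: finI_mono EL => N EN; split; first exact: EF.
    by move=> NM; apply: nEM; rewrite -NM.
  have [l Ll Ml] : sum_set L M (x M - y).
    by rewrite (maximal_sum (Fm _ FM).1).
  exists (E `|` [set M]), (L `&` M), (y + l); split.
  + by move=> N [/EF//|->].
  + by apply: finI_cons; [apply: finI_mono EL => N; left|right].
  + by move=> N [EN|->] c [Cc Mc] //; apply: EC.
  + move=> c m [Cc Mc] [Lm Mm]; split; first exact: LC.
    by rewrite /coset /= addrAC; apply: lidealD => //; apply: hm.
  + split; first exact: LC.
    have hM := hm _ FM; apply: lideal_sym => //.
    by rewrite opprD addrA.
by exists y => M FM; apply: (hy (coset M (x M))); exists M.
Qed.

(** * Powers of closed ideals *)

Lemma tideal_bpower L n : tideal L -> tideal (bpower K L n).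
Proof.
by move=> hL; elim: n => [|n IH] //=; apply: tideal_bclosure => //; apply: tideal_iprod.
Qed.

Lemma bclosed_bpower L n : bclosed K L -> bclosed K (bpower K L n).
Proof. by case: n => [|n] // _; apply: bclosed_bclosure. Qed.

Lemma bpower_decr L n : closed_tideal K L -> bpower K L n.+1 `<=` bpower K L n.
Proof.
move=> [cL hL]; have h := tideal_bpower n hL.
apply: bclosure_sub; first exact: bclosed_bpower.
by apply: iprod_sub (tideal_left h) _ => x y Lx _; apply: tidealM.
Qed.

Lemma bpower_homo L n m : closed_tideal K L -> (n <= m)%N ->
  bpower K L m `<=` bpower K L n.
Proof.
move=> hL; elim: m => [|m IH]; first by rewrite leqn0 => /eqP->.
rewrite leq_eqVlt => /predU1P[->//|/IH h].
exact: subset_trans (bpower_decr hL) h.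
Qed.

Lemma bpower_expr L n x : L x -> bpower K L n (x ^+ n.+1).
Proof.
move=> Lx; elim: n => [|n IH] //; rewrite exprSr.
by apply: sub_bclosure => //; apply: iprod_mem.
Qed.

(** Some power of L lies in K_i by [chevalley], so any z in L is nilpotent modulo K_i;
    then 1 - z, which divides 1 - z^m, lies in no maximal left ideal containing K_i. *)
Lemma pronilpotent_sub_jacobson L : closed_tideal K L ->
  \bigcap_n bpower K L n = [set 0] -> L `<=` @jacobson R.
Proof.
move=> hL L0 x Lx; rewrite (jacobson_open_maximal hK) => M [mM [i KM]].
have hM : lideal M by case: mM.
apply: contrapT => nMx; have [y My] := maximal_elt mM nMx.
have Lz : L (y * x) by apply: lidealM => //; case: hL => _ [].
move: (y * x) Lz My => z Lz My.
have [|C FC sC] := @chevalley [set bpower K L n | n in setT] i.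
  move=> _ [n _ <-]; split; first by apply: bclosed_bpower; case: hL.
  by apply/tideal_left/tideal_bpower; case: hL.
have [n nC] : exists n, bpower K L n `<=` C.
  elim: {sC} FC => [|A _ _ [n nA] [m _ <-]]; first by exists 0%N.
  exists (maxn n m) => w hw; split.
    by apply: nA; apply: bpower_homo hw => //; apply: leq_maxl.
  by apply: bpower_homo hw => //; apply: leq_maxr.
have Kz : K i (z ^+ n.+1).
  have [c hc] := sC _ (nC _ (bpower_expr n Lz)).
  suff -> : c = 0 by rewrite subr0.
  have : (\bigcap_n bpower K L n) c by move=> m _; apply: hc; exists m.
  by rewrite L0.
apply: (maximal1 mM); apply: (lideal_transl hM _ (KM _ Kz)).
elim: {Kz nC} n.+1 => [|m IH]; first by rewrite expr0 subrr; apply: lideal0.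
apply: (lideal_trans hM My); rewrite exprS -[X in M (X - _)]mulr1 -mulrBr.
exact: lidealM.
Qed.

(** For E a power of J with E + K_i minimal, E is contained in E J + K_i.  If E is not
    contained in K_i, choose L minimal among the left ideals with E L not in K_i, and l in
    L with E l not in K_i.  As E J l is not in K_i either, J l + K_i = L, so that
    l = j l modulo K_i with j in J; as 1 - j is invertible, l is in K_i. *)
Lemma jacobson_pronilpotent : \bigcap_n bpower K (@jacobson R) n = [set 0].
Proof.
set J := @jacobson R.
have hJ : closed_tideal K J by split; [exact: bclosed_jacobson|exact: tideal_jacobson].
have hp n : tideal (bpower K J n) by apply: tideal_bpower; case: hJ.
apply/seteqP; split=> [x hx|_ -> n _]; last exact: (lideal0 (tideal_left (hp n))).
apply: (base_sep hK) => i.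
pose G := [set V | exists n, V = sum_set (bpower K J n) (K i)].
have [||_ [n ->] Gmin] := @hart i G.
- by exists (sum_set (bpower K J 0) (K i)), 0%N.
- move=> _ [n ->]; split; first exact: (lideal_sum (tideal_left (hp n))).
  exact: (sub_sumr (tideal_left (hp n))).
set E := bpower K J n.
have hE : tideal E := hp n.
have EE : E `<=` sum_set (iprod E J) (K i).
  move=> e Ee.
  have [|||f Ef Kf] := Gmin (sum_set (bpower K J n.+1) (K i)) _ _ e.
  - by exists n.+1.
  - by move=> v [u Eu vu]; exists u => //; apply: bpower_decr.
  - exact: sub_suml.
  have [g Eg Kg] := Ef i.
  by exists g => //; apply: lideal_trans Kf Kg.
suff EK : E `<=` K i by apply: EK; apply: hx.
apply: contrapT => nEK.
pose H := [set L | [/\ lideal L, K i `<=` L & exists e l, [/\ E e, L l & ~ K i (e * l)]]].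
have [||L [hL KL [e [l [Ee Ll nK]]]] Hmin] := @hart i H.
- exists setT; split=> //.
  apply: contrapT => h; apply: nEK => e Ee; apply: contrapT => nKe.
  by apply: h; exists e, 1; rewrite mulr1.
- by move=> L [].
pose Jl := [set j * l | j in J].
have hJ1 : lideal J by case: hJ => _ [].
have hJl : lideal Jl.
  split; first by exists 0; [exact: (lideal0 hJ1)|rewrite mul0r].
    move=> _ _ [a Ja <-] [b Jb <-].
    by exists (a + b); [exact: (lidealD hJ1)|rewrite mulrDl].
  by move=> b _ [a Ja <-]; exists (b * a); [exact: (lidealM _ hJ1)|rewrite mulrA].
have [||_ [j Jj <-] Kj] := Hmin (sum_set Jl (K i)) _ _ l Ll.
- split; [exact: lideal_sum|exact: sub_sumr|].
  apply: contrapT => h; apply: nK.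
  have [f Ef Kf] := EE _ Ee.
  apply: (@lideal_transl _ (K i) _ (f * l)) => //.
    by rewrite -mulrBl; apply: base_right.
  suff : iprod E J `<=` [set f | K i (f * l)] by apply.
  apply: iprod_sub => [|u v Eu Jv].
    split; first by rewrite /= mul0r; apply: lideal0.
      by move=> a b /= ha hb; rewrite mulrDl; apply: lidealD.
    by move=> a b /= hb; rewrite -mulrA; apply: lidealM.
  apply: contrapT => nKuv; apply: h; exists u, (v * l); split=> //.
    by apply: sub_suml => //; exists v.
  by rewrite mulrA.
- by apply: sum_sub => // _ [j Jj <-]; apply: lidealM.
have [w [hw _]] := jacobson_inv Jj.
apply: nK; apply: (lidealM _ (Kl i)); rewrite -[l]mul1r -hw -mulrA.
by apply: (lidealM _ (Kl i)); rewrite mulrBl mul1r.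
Qed.

End Compactness.

(** * The topology of products and of inverse limits *)

Section ProductTopology.
Variables (I : Type) (T : I -> topologicalType).

(** Cylinders over neighbourhoods are neighbourhoods in the product topology. *)
Lemma nbhs_cylinder (t : prod_topology T) i (V : set (T i)) :
  nbhs (t i) V -> nbhs t [set f : prod_topology T | V (f i)].
Proof.
move=> tV; have h : nbhs t --> t by apply: cvg_id.
have /cvg_sup/(_ i) hi := h; apply: hi.
exact: (@initial_continuous _ _ (fun f : forall i, T i => f i) t _ tV).
Qed.

(** Convergence in the product topology is componentwise. *)
Lemma cvg_prod_topology (F : set_system (forall i, T i)) (t : prod_topology T) :
  Filter F -> (forall i (V : set (T i)), nbhs (t i) V -> F [set f | V (f i)]) ->
  F --> t.
Proof.
move=> FF h; apply/cvg_sup => i A [_ [[W oW <-] Wt WA]].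
apply: filterS WA _; apply: h; apply: open_nbhs_nbhs; split=> //.
Qed.

End ProductTopology.

Section LimitTopology.
Variables (I : Type) (le : I -> I -> Prop) (U : I -> topologicalType).
Variables (phi : forall i j, le i j -> U j -> U i).
Variables (X : topologicalType) (p : forall i, X -> U i).
Hypotheses (dle : directed le) (limX : is_inverse_limit phi p).
Hypothesis discU : forall i (u : U i), nbhs u [set u].

(** In a directed inverse limit of discrete spaces the fibres of the projections form
    bases of neighbourhoods. *)
Lemma limit_nbhs (x : X) (A : set X) :
  nbhs x A <-> exists i, forall y, p i y = p i x -> A y.
Proof.
case: limX => comp _ top; case: dle => -[i0] _ _ dir; split.
  rewrite nbhsE => -[_ [/top[W oW ->] Wx] WA].
  (* The filter of the images of the fibres through x converges to the image of x. *)
  pose F : set_system (forall i, U i) :=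
    [set P | exists i, forall y, p i y = p i x -> P (fun j => p j y)].
  have FF : Filter F.
    split; first by exists i0.
      move=> P Q [i hi] [j hj]; have [l [il jl]] := dir i j; exists l => y ly.
      by split; [apply: hi; rewrite -!(comp _ _ il) ly|apply: hj; rewrite -!(comp _ _ jl) ly].
    by move=> P Q PQ [i hi]; exists i => y /hi /PQ.
  have cF : F --> ((fun i => p i x) : prod_topology U).
    apply: cvg_prod_topology => i V /nbhs_singleton Vx.
    by exists i => y /= ->.
  have [|i hi] := cF W; first by apply: open_nbhs_nbhs.
  by exists i => y /hi Wy; apply: WA.
move=> [i hi]; rewrite nbhsE.
exists [set y | p i y = p i x]; last by move=> y /hi.
split=> //; apply/top; exists [set f : prod_topology U | f i = p i x] => //.
rewrite openE => f /= fi; apply: (@nbhs_cylinder _ _ f i [set p i x]).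
by rewrite fi; apply: discU.
Qed.

End LimitTopology.

(** * Subspaces of finite codimension *)

Section FiniteDimension.
Variables (k : fieldType) (A : pzAlgType k).
Implicit Types (L V W : set A).

Local Notation "c %:S" := (scalar_map c : A) (at level 2, format "c %:S").

(** Linear combinations over k. *)
Definition comb n (c : 'I_n -> k) (v : 'I_n -> A) : A := \sum_(i < n) (c i)%:S * v i.

(** Linear dependence modulo L. *)
Definition dependent L n (v : 'I_n -> A) :=
  exists2 c : 'I_n -> k, (exists i, c i != 0) & L (comb c v).

(** Any n vectors are dependent modulo L; for a subspace this says that its codimension
    is less than n.  Unlike a spanning family it passes at once to preimages under
    maps that are not surjective. *)
Definition fcodim L n := forall v : 'I_n -> A, dependent L v.

(** Linear independence modulo L. *)
Definition independent L n (v : 'I_n -> A) :=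
  forall c : 'I_n -> k, L (comb c v) -> forall i, c i = 0.

Lemma scalarKV c (x : A) : c != 0 -> (c^-1)%:S * (c%:S * x) = x.
Proof. by move=> c0; rewrite mulrA -rmorphM mulVf // rmorph1 mul1r. Qed.

Lemma lideal_scalar L c x : lideal L -> c != 0 -> L (c%:S * x) -> L x.
Proof. by move=> hL c0 Lx; rewrite -(scalarKV x c0); apply: lidealM. Qed.

Definition vcons n (x : A) (v : 'I_n -> A) (i : 'I_n.+1) : A :=
  oapp v x (unlift ord0 i).

Lemma comb_vcons n (c : 'I_n.+1 -> k) x (v : 'I_n -> A) :
  comb c (vcons x v) = (c ord0)%:S * x + comb (fun i => c (lift ord0 i)) v.
Proof.
rewrite /comb big_ord_recl /vcons unlift_none; congr (_ + _).
by apply: eq_bigr => i _; rewrite liftK.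
Qed.

(** Passing from L to a smaller L' allows a longer independent family. *)
Lemma independent_step L L' n (v : 'I_n -> A) x : lideal L -> lideal L' ->
  L' `<=` L -> L x -> ~ L' x -> independent L v -> independent L' (vcons x v).
Proof.
move=> hL hL' LL Lx nLx hv c; rewrite comb_vcons => hc.
have c0 i : c (lift ord0 i) = 0.
  apply: hv (fun i => c (lift ord0 i)) _ i.
  by have := lidealB hL (LL _ hc) (lidealM (c ord0)%:S hL Lx); rewrite addrAC subrr add0r.
move=> i; case: (unliftP ord0 i) => [j ->|->] //.
apply/eqP; apply: contrapT => /negP cn0; apply: nLx.
apply: (lideal_scalar hL' cn0); move: hc; rewrite /comb big1 ?addr0 // => j _.
by rewrite c0 rmorph0 mul0r.
Qed.

Lemma fcodim_bound L n (v : 'I_n -> A) : fcodim L n -> ~ independent L v.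
Proof. by move=> hL hv; have [c [i ci] /hv/(_ i)/eqP] := hL v; rewrite (negPf ci). Qed.

Lemma fcodim_sub L L' n : L `<=` L' -> fcodim L n -> fcodim L' n.
Proof. by move=> LL hL v; have [c ? ?] := hL v; exists c => //; apply: LL. Qed.

Lemma independent0 L (v : 'I_0 -> A) : independent L v.
Proof. by move=> c _ []. Qed.

(** A member of F with an independent family of maximal size is minimal. *)
Lemma fcodim_minimal V N (F : set (set A)) : fcodim V N -> F !=set0 ->
  (forall L, F L -> lideal L /\ V `<=` L) ->
  exists2 L, F L & forall L', F L' -> L' `<=` L -> L `<=` L'.
Proof.
move=> hV [L0 FL0] hF.
suff H d : forall n, N = (n + d)%N -> forall L (v : 'I_n -> A), F L -> independent L v ->
    exists2 L, F L & forall L', F L' -> L' `<=` L -> L `<=` L'.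
  exact: (H N 0%N _ L0 (fun=> 0) FL0 (@independent0 _ _)).
elim: d => [|d IH] n Nn L v FL hv.
  exfalso; rewrite addn0 in Nn; subst N; apply: (fcodim_bound _ hv).
  by apply: fcodim_sub hV; case: (hF _ FL).
have [min|/existsNP[L' /not_implyP[FL' /not_implyP[L'L nLL']]]] :=
  pselect (forall L', F L' -> L' `<=` L -> L `<=` L'); first by exists L.
have [x [Lx nL'x]] : exists x, L x /\ ~ L' x.
  by apply: contrapT => h; apply: nLL' => x Lx; apply: contrapT => nx; apply: h; exists x.
apply: (IH n.+1 _ L' (vcons x v) FL'); first by rewrite Nn addSnnS.
by apply: independent_step hv => //; [case: (hF _ FL)|case: (hF _ FL')].
Qed.

(** An independent family of maximal size spans modulo L. *)
Lemma fcodim_generators L N : lideal L -> fcodim L N ->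
  exists n (v : 'I_n -> A), forall x, exists c : 'I_n -> k, L (x - comb c v).
Proof.
move=> hL hN.
suff H d : forall n, N = (n + d)%N -> forall (v : 'I_n -> A), independent L v ->
    exists n (v : 'I_n -> A), forall x, exists c : 'I_n -> k, L (x - comb c v).
  exact: (H N 0%N _ (fun=> 0) (@independent0 _ _)).
elim: d => [|d IH] n Nn v hv.
  by exfalso; rewrite addn0 in Nn; subst N; apply: (fcodim_bound hN hv).
have [gen|/existsNP[x nx]] := pselect (forall x, exists c : 'I_n -> k, L (x - comb c v)).
  by exists n, v.
apply: (IH n.+1 _ (vcons x v)); first by rewrite Nn addSnnS.
move=> c; rewrite comb_vcons => hc.
have c0 : c ord0 = 0.
  apply/eqP; apply: contrapT => /negP cn0; apply: nx.
  exists (fun i => - ((c ord0)^-1 * c (lift ord0 i))).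
  apply: (lideal_scalar hL cn0); rewrite mulrBr.
  suff -> : (c ord0)%:S * comb (fun i => - ((c ord0)^-1 * c (lift ord0 i))) v =
    - comb (fun i => c (lift ord0 i)) v by rewrite opprK.
  rewrite /comb mulr_sumr -sumrN; apply: eq_bigr => i _.
  by rewrite mulrA -rmorphM mulrN mulVKf // rmorphN mulNr.
move=> i; case: (unliftP ord0 i) => [j ->|->] //.
by move: hc; rewrite c0 rmorph0 mul0r add0r => /hv; apply.
Qed.

(** With B spanned by n elements, n + 1 vectors of A have images whose coordinate
    matrix has a nonzero row in its left kernel. *)
Lemma fcodim_kernel (B : pzAlgType k) (p : A -> B) :
  finite_dimensional B^o -> algebra_morphism p ->
  exists N, fcodim [set x | p x = 0] N.
Proof.
move=> [n [e he]] [pB [_ pM] pS].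
have p0 : p 0 = 0 by rewrite -[in LHS](subrr 0) pB subrr.
have pN x : p (- x) = - p x by rewrite -[- x]add0r pB p0 add0r.
have pD x y : p (x + y) = p x + p y by rewrite -[y in LHS]opprK pB pN opprK.
exists n.+1 => v; have [C hC] := boolp.choice (fun i => he (p (v i))).
pose M := \matrix_(i < n.+1, j < n) C i j.
have : kermx M != 0.
  rewrite kermx_eq0 /row_free; apply/eqP => rM.
  by have := rank_leq_col M; rewrite rM ltnn.
move=> /rowV0Pn[u /sub_kermxP uM u0]; exists (fun i => u 0 i).
  have [i ui] : exists i, u 0 i != 0.
    apply: contrapT => h; move/eqP: u0; apply; apply/rowP => i; rewrite mxE.
    by apply/eqP; apply: contrapT => /negP ui; apply: h; exists i.
  by exists i.
have psum (F : 'I_n.+1 -> A) : p (\sum_(i < n.+1) F i) = \sum_(i < n.+1) p (F i).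
  by elim/big_rec2: _ => [|i x y _ <-].
rewrite /comb /= psum.
under eq_bigr => i _ do rewrite pM pS hC mulr_sumr.
rewrite exchange_big /= big1 // => j _.
transitivity ((scalar_map ((u *m M) 0 j) : B) * e j); last first.
  by rewrite uM mxE rmorph0 mul0r.
rewrite mxE rmorph_sum mulr_suml; apply: eq_bigr => i _.
by rewrite mxE rmorphM -mulrA.
Qed.

End FiniteDimension.

(** * The open ideals of a pseudocompact algebra *)

Section Pseudocompact.
Variables (k : fieldType) (A : preTopologicalPzAlgType k).

(** The K_i are the kernels of the projections; these need not be surjective. *)
Lemma pseudocompact_base_of_algebra : pseudocompact_algebra A ->
  exists (I : Type) (K : I -> set A),
    [/\ pseudocompact_base K, forall i, exists N, fcodim (K i) N
      & forall (x : A) (U : set A), nbhs x U <-> exists i, forall y : A, K i (y - x) -> U y].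
Proof.
move=> [I [le [B [phi [p [dle fd [[sys1 sys2] am] pm lim]]]]]].
have p0 i : p i 0 = 0 by case: (pm i) => pB _ _; rewrite -[in LHS](subrr 0) pB subrr.
have pB i x y : p i (x - y) = p i x - p i y by case: (pm i).
have pM i x y : p i (x * y) = p i x * p i y by case: (pm i) => _ [_ +] _; apply.
have pD i x y : p i (x + y) = p i x + p i y.
  by rewrite -[y in LHS]opprK pB -[- y]add0r pB p0 add0r opprK.
have phi0 i j (h : le i j) : phi i j h 0 = 0.
  by case: (am i j h) => fB _ _; rewrite -[in LHS](subrr 0) fB subrr.
have [comp ex _] := lim.
exists I, (fun i => [set x | p i x = 0]); split.
- case: (dle) => inh _ _ dir; split=> //.
  + move=> i; split=> // [x y|a x] /=; first by rewrite pD => -> ->; rewrite addr0.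
    by rewrite pM => ->; rewrite mulr0.
  + by move=> i a x /= h; rewrite pM h mul0r.
  + move=> i j; have [l [il jl]] := dir i j; exists l; split=> x /= lx.
      by rewrite -(comp _ _ il) lx phi0.
    by rewrite -(comp _ _ jl) lx phi0.
  + move=> x hx; have [|z [_ zu]] := ex (fun i => 0); first by move=> i j h; apply: phi0.
    by rewrite -(zu x) // -(zu 0).
  + move=> a ha; have [|x [hx _]] := ex (fun i => p i (a i)).
      move=> i j h; rewrite comp; apply/eqP; rewrite -subr_eq0 -pB; apply/eqP/ha.
      by move=> x /= jx; rewrite -(comp _ _ h) jx phi0.
    by exists x => i /=; rewrite pB hx subrr.
- by move=> i; apply: fcodim_kernel.
move=> x U; rewrite (limit_nbhs dle lim); last by move=> i u; apply: discrete_set1.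
split=> -[i hi]; exists i => y.
  by move=> /= h; apply: hi; apply/eqP; rewrite -subr_eq0 -pB h.
by move=> h; apply: hi; rewrite /= pB h subrr.
Qed.

End Pseudocompact.

(** * Quotient modules *)

(** Subsets closed under the module operations, as bundled submodules. *)
Lemma ex_submodClosed (R : pzRingType) (M : lmodType R) (P : set M) :
  P 0 -> (forall x y, P x -> P y -> P (x + y)) -> (forall a x, P x -> P (a *: x)) ->
  exists N : submodClosed M, [set` N] = P.
Proof.
move=> P0 PD PZ; pose S : M -> bool := fun x => `[< P x >].
have Scl : subsemimod_closed S.
  split; last by move=> a x /asboolP Px; apply/asboolP/PZ.
  split; first by apply/asboolP.
  by move=> x y /asboolP Px /asboolP Py; apply/asboolP/PD.
pose N : submodClosed M := HB.pack S (GRing.isSubmodClosed.Build R M S Scl).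
exists N; apply/seteqP; split=> x /=; first by move=> /asboolP.
by move=> Px; apply/asboolP.
Qed.

Section QuotientProjection.
Variables (R : pzRingType) (M : preTopologicalModType R) (N : submodClosed M).

(** The projection onto the quotient module. *)
Definition quotient_pi (x : M) : quotient_module N :=
  \pi_(Quotient.quot (submod_zmodClosed N))%qT x.

Lemma quotient_pi_eq x y : quotient_pi x = quotient_pi y <-> [set` N] (x - y).
Proof.
rewrite /quotient_pi /=; have := Quotient.idealrBE (submod_zmodClosed N) x y.
move=> h; split=> [e|].
  by have : x - y \in submod_zmodClosed N by rewrite h e eqxx.
by move=> e; apply/(@eqP (Quotient.quot (submod_zmodClosed N))); rewrite -h.
Qed.

Lemma quotient_pi_surj (u : quotient_module N) : exists x, u = quotient_pi x.
Proof.
by exists (repr (u : Quotient.quot (submod_zmodClosed N))); rewrite /quotient_pi reprK.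
Qed.

Lemma quotient_piD x y : quotient_pi (x + y) = quotient_pi x + quotient_pi y.
Proof. by rewrite /quotient_pi [LHS]raddfD. Qed.

Lemma quotient_pi0 : quotient_pi 0 = 0. Proof. by rewrite /quotient_pi [LHS]raddf0. Qed.

Lemma quotient_piZ a x : quotient_pi (a *: x) = a *: quotient_pi x.
Proof. exact: esym (quotient_scale_pi N a x). Qed.

Lemma quotient_pi_sum n (F : 'I_n -> M) :
  quotient_pi (\sum_(i < n) F i) = \sum_(i < n) quotient_pi (F i).
Proof. by elim/big_rec2: _ => [|i x y _ <-]; [exact: quotient_pi0|rewrite quotient_piD]. Qed.

Lemma open_quotient_pi (O : set (quotient_module N)) :
  open O <-> open (quotient_pi @^-1` O).
Proof. by []. Qed.

End QuotientProjection.

(** * Simple pseudocompact modules and products of them *)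

Section Topology.
Variables (k : fieldType) (A : preTopologicalPzAlgType k) (I : Type) (K : I -> set A).
Hypothesis hK : pseudocompact_base K.
Hypothesis hfd : forall i, exists N, fcodim (K i) N.
Hypothesis nbhsK : forall (x : A) (U : set A),
  nbhs x U <-> exists i, forall y : A, K i (y - x) -> U y.

Let Kl := base_left hK.

(** Left ideals are subspaces, so finite codimension gives the artinian property. *)
Lemma artinian_fcodim : artinian K.
Proof.
move=> i F F0 hF; have [N hN] := hfd i.
exact: fcodim_minimal hN F0 hF.
Qed.

Lemma closure_bclosure (C : set A) : closure C = bclosure K C.
Proof.
apply/seteqP; split=> [x hx i|x hx U /nbhsK[i hi]].
  have [|c [Cc Kc]] := hx [set y | K i (y - x)]; first by apply/nbhsK; exists i.
  by exists c => //; apply: lideal_sym.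
by have [c Cc Kc] := hx i; exists c; split=> //; apply: hi; apply: lideal_sym.
Qed.

Lemma closed_bclosed (C : set A) : closed C <-> bclosed K C.
Proof. by rewrite /bclosed -closure_bclosure. Qed.

(** A union of K_i-cosets is open. *)
Lemma open_saturated (O : set A) i : (forall x y, O x -> K i (y - x) -> O y) -> open O.
Proof. by move=> h; rewrite openE => x Ox; apply/nbhsK; exists i => y; apply: h. Qed.

Lemma closed_left_idealE : @closed_left_ideal k A = closed_lideal K.
Proof.
apply/funext => L; apply/propext; split=> -[cL hL]; split=> //; exact/closed_bclosed.
Qed.

(** Closed right ideals are the closed left ideals of the opposite ring. *)
Lemma closed_right_idealE : @closed_right_ideal k A = @closed_lideal A^c I K.
Proof.
apply/funext => L; apply/propext; split=> -[cL hL]; split=> //; exact/closed_bclosed.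
Qed.

Lemma closed_idealE : @closed_ideal k A = closed_tideal K.
Proof.
apply/funext => L; apply/propext; split=> -[cL hL]; split=> //; exact/closed_bclosed.
Qed.

Lemma closed_powerE (L : set A) n : closed_power L n = bpower K L n.
Proof. by elim: n => [|n IH] //=; rewrite closure_bclosure IH. Qed.

(** The family K_i also serves for the opposite ring. *)
Lemma pseudocompact_base_conv : @pseudocompact_base A^c I K.
Proof.
case: hK => hl hr inh dir sep comp; split=> //.
  by move=> i; split; [case: (hl i)|case: (hl i)|move=> a x; apply: hr].
by move=> i a x Kx; apply: (lidealM (a : A) (hl i)).
Qed.

Local Notation LA := (left_regular A).

Lemma ex_submod_ideal (L : set A) : lideal L ->
  exists W : submodClosed LA, [set` W] = L :> set A.
Proof. by move=> [h0 hD hM]; apply: (@ex_submodClosed A LA L). Qed.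

Section Quotient.
Variables (M : set A) (W : submodClosed LA).
Hypotheses (mM : open_maximal K M) (WM : [set` W] = M :> set A).
Let hM : lideal M. Proof. by case: mM => -[]. Qed.

Lemma quotient_pi_ideal (x y : LA) : quotient_pi W x = quotient_pi W y <-> M ((x : A) - y).
Proof. by rewrite quotient_pi_eq -WM. Qed.

(** A / M is discrete. *)
Lemma open_quotient_max (O : set (quotient_module W)) : open O.
Proof.
case: mM => _ [i KM]; apply/open_quotient_pi.
apply: (@open_saturated _ i) => x y Ox Kxy; rewrite /preimage /=.
suff -> : quotient_pi W y = quotient_pi W x by [].
by apply/quotient_pi_ideal/KM.
Qed.

Lemma finite_dimensional_quotient_max : finite_dimensional (quotient_module W).
Proof.
case: mM => _ [i KM]; have [N hN] := hfd i.
have [n [v gen]] := fcodim_generators hM (fcodim_sub KM hN).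
exists n, (fun i => quotient_pi W (v i)) => u; have [x ->] := quotient_pi_surj u.
have [c hc] := gen x; exists c.
have -> : quotient_pi W x = quotient_pi W (comb c v : LA) by apply/quotient_pi_ideal.
rewrite [LHS](quotient_pi_sum W (fun i => (scalar_map (c i) : A) *: (v i : LA))).
by apply: eq_bigr => j _; rewrite quotient_piZ.
Qed.

(** A / M is finite dimensional and discrete, thus the limit of a system indexed by one
    point. *)
Lemma pseudocompact_quotient_max : pseudocompact_module (quotient_module W).
Proof.
exists unit, (fun _ _ => True), (fun _ => quotient_module W : lmodType A),
  (fun _ _ _ u => u), (fun _ u => u); split.
- by split=> // i j; exists tt.
- move=> _; split; first exact: finite_dimensional_quotient_max.
  move=> [a u] O /= /nbhs_singleton Oau.
  have [x ux] := quotient_pi_surj (u : quotient_module W).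
  case: mM => _ [i KM].
  exists ([set b | K i (b - a)], [set u]).
    by split; [apply/nbhsK; exists i|apply: discrete_set1].
  move=> [b v] /= [Kb ->]; move: Oau; rewrite /= ux -!quotient_piZ.
  suff -> : quotient_pi W (b *: x) = quotient_pi W (a *: x) by [].
  apply/quotient_pi_ideal; rewrite -[(_ : A) - _]mulrBl; apply/KM/(base_right hK) => //.
- by split.
- by move=> _ a u v.
- split=> // [u _|O]; first by exists (u tt); split=> [[]|v /(_ tt) ->].
  split=> [_|_]; last exact: open_quotient_max.
  exists [set f | O (f tt)] => //.
  rewrite openE => f Of.
  apply: (@nbhs_cylinder _ _ f tt O); apply: open_nbhs_nbhs; split=> //.
  exact: discrete_open.
Qed.

Lemma simple_quotient_max : simple_pseudocompact (quotient_module W).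
Proof.
split; first exact: pseudocompact_quotient_max.
  exists (quotient_pi W (1 : A)); apply/eqP; rewrite -(quotient_pi0 W) => /quotient_pi_ideal.
  by rewrite subr0; apply: (maximal1 mM.1).
move=> N _; pose L : set A := [set x | [set` N] (quotient_pi W x)].
have hL : lideal L.
  split; first by rewrite /L /= [quotient_pi W 0]quotient_pi0 rpred0.
    by move=> x y Lx Ly; rewrite /L /= (quotient_piD W x y); apply: rpredD.
  by move=> a x Lx; rewrite /L /= (quotient_piZ W a x); apply: rpredZ.
have ML : M `<=` L.
  move=> x Mx; rewrite /L /=; have -> : quotient_pi W x = 0; last exact: rpred0.
  by rewrite -(quotient_pi0 W); apply/quotient_pi_ideal; rewrite subr0.
have [LT|nLT] := pselect (L = setT); [right|left]; apply/seteqP; split=> // u.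
- by move=> _; have [x ->] := quotient_pi_surj u; have : L x by rewrite LT.
- have [x ->] := quotient_pi_surj u; move=> Nx; have : L x by [].
  case: mM => -[_ _ Mmax] _; rewrite (Mmax L) // => Mx.
  by rewrite /= -(quotient_pi0 W); apply/quotient_pi_ideal; rewrite subr0.
- by move=> ->; apply: rpred0.
Qed.

End Quotient.

(** Some projection S -> U_i is injective, its kernel being a proper closed submodule; so
    all submodules of S are closed.  If a s is nonzero, it generates S, so s = b a s for
    some b, which is impossible since 1 - b a is left invertible. *)
Lemma jacobson_annihilator (S : preTopologicalModType A) (a : A) :
  simple_pseudocompact S -> jacobson a -> annihilator S a.
Proof.
move=> [[J [le [U [phi [p [dle _ [_ _] plin lim]]]]]] [s0 s0n] simple] qa s.
have p0 i : p i 0 = 0.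
  have := plin i (-1) 0 0; rewrite scaler0 addr0 => ->.
  by rewrite scaleN1r addNr.
have clS (C : set S) : (forall x, (forall i, exists2 c, C c & p i c = p i x) -> C x) ->
    closed C.
  move=> hC x hx; apply: hC => i.
  have [|c [Cc ic]] := hx [set y | p i y = p i x].
    apply/(limit_nbhs dle lim); last by exists i.
    by move=> j u; apply: discrete_set1.
  by exists c.
(* Otherwise every kernel is S, so every p_i kills s0, and s0 = 0. *)
have [i pinj] : exists i, forall x, p i x = 0 -> x = 0.
  apply: contrapT => h; move/eqP: s0n; apply.
  have pz i : p i s0 = 0.
    have [N NE] : exists N : submodClosed S, [set` N] = [set x | p i x = 0].
      apply: ex_submodClosed => //= [x y px py|b x px].
        by rewrite -[x]scale1r plin px py scaler0 addr0.
      by rewrite -[b *: x]addr0 plin px p0 scaler0 addr0.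
    case: (simple N).
    - by rewrite NE; apply: clS => x /(_ i)[c /= c0 <-].
    - rewrite NE => N0; exfalso; apply: h; exists i => x px.
      by have : [set x | p i x = 0] x by []; rewrite N0.
    - by rewrite NE => NT; have : [set x | p i x = 0] s0 by rewrite NT.
  have [comp ex _] := lim.
  have [|z [_ zu]] := ex (fun i => p i s0); first by move=> j l h'; apply: comp.
  by rewrite -(zu s0) // -(zu 0) // => j; rewrite pz p0.
have pB x y : p i x = p i y -> x = y.
  move=> e; apply/eqP; rewrite -subr_eq0; apply/eqP/pinj.
  by rewrite addrC -scaleN1r plin e scaleN1r addNr.
have [N NE] : exists N : submodClosed S, [set` N] = [set b *: (a *: s) | b in setT].
  apply: ex_submodClosed => [|_ _ [b _ <-] [c _ <-]|b _ [c _ <-]].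
  - by exists 0 => //; rewrite scale0r.
  - by exists (b + c) => //; rewrite scalerDl.
  - by exists (b * c) => //; rewrite -scalerA.
case: (simple N).
- by apply: clS => x /(_ i)[c Cc /pB <-].
- rewrite NE => N0; suff : [set b *: (a *: s) | b in setT] (a *: s) by rewrite N0.
  by exists 1; rewrite ?scale1r.
- rewrite NE => NT; have [b _ hb] : [set b *: (a *: s) | b in setT] s by rewrite NT.
  have [w hw] := qa b.
  have -> : s = 0; last by rewrite scaler0.
  by rewrite -[s]scale1r -hw -scalerA scalerBl scale1r -scalerA hb subrr scaler0.
Qed.

(** The simple modules A / M suffice for the inclusion from right to left. *)
Lemma jacobson_annihilators :
  @jacobson A = [set a | forall S : preTopologicalModType A,
    simple_pseudocompact S -> annihilator S a].
Proof.
apply/seteqP; split=> [a qa S sS|a ha]; first exact: jacobson_annihilator.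
rewrite (jacobson_open_maximal hK) => M mM.
have [W WM] := ex_submod_ideal (let: conj (And3 h _ _) _ := mM in h).
have := ha _ (simple_quotient_max mM WM) (quotient_pi W (1 : A)).
rewrite -(quotient_piZ W a) -(quotient_pi0 W) => /(quotient_pi_ideal WM).
by rewrite subr0 -[_ *: _]/(a * 1) mulr1.
Qed.

(** A / J is topologically isomorphic to the product of the A / M, with M in a maximal
    independent family F of open maximal left ideals. *)
Lemma product_of_simples_jacobson :
  closed_with_product_of_simples_quotient (@jacobson A).
Proof.
have hart := artinian_fcodim.
have [W WJ] := ex_submod_ideal (@lideal_jacobson A).
exists W; split; [by rewrite WJ|exact/closed_bclosed/(bclosed_jacobson hK)|].
have [F [Fm Fi] FJ] := ex_coindep hK.
have hm M : F M -> lideal M by case/Fm => -[].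
have exW (m : {M | F M}) : exists N : submodClosed LA, [set` N] = sval m :> set A.
  by case: m => M FM; apply/ex_submod_ideal/hm.
have [w hw] := boolp.choice exW.
have qW x y : quotient_pi W x = quotient_pi W y <-> jacobson ((x : A) - y).
  by rewrite quotient_pi_eq -WJ.
have qw m x y : quotient_pi (w m) x = quotient_pi (w m) y <-> sval m ((x : A) - y).
  by rewrite quotient_pi_eq -hw.
pose S (m : {M | F M}) : preTopologicalModType A := quotient_module (w m).
(* The map f is induced by the projections A -> A / M, and g is its inverse. *)
have [rep hrep] := boolp.choice (@quotient_pi_surj _ _ W).
pose f (u : quotient_module W) : prod_topology S := fun m => quotient_pi (w m) (rep u).
have fq x m : f (quotient_pi W x) m = quotient_pi (w m) x.
  apply/qw; have /qW := hrep (quotient_pi W x).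
  by rewrite -FJ => h; apply: lideal_sym; [apply: hm; case: m|apply: h; case: m].
have finj u v : f u = f v -> u = v.
  have [x ->] := quotient_pi_surj u; have [y ->] := quotient_pi_surj v => fxy.
  apply/qW; rewrite -FJ => M FM; apply/(qw (exist _ M FM)).
  by rewrite -!fq fxy.
have fsurj (s : prod_topology S) : exists u, f u = s.
  have [x hx] := boolp.choice (fun m => quotient_pi_surj (s m)).
  pose x' M : A := if pselect (F M) is left FM then x (exist _ M FM) else 0.
  have [y hy] := coindep_surj hK hart x' (conj Fm Fi).
  exists (quotient_pi W y); apply: functional_extensionality_dep => -[M FM].
  rewrite fq hx; apply/qw; have := hy _ FM; rewrite /x'; case: pselect => // FM'.
  by rewrite (Prop_irrelevance FM' FM).
have [g fg] := boolp.choice fsurj.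
have gf : cancel f g by move=> u; apply: finj; rewrite fg.
exists {M | F M}, S, f, g; split.
- by move=> [M FM]; apply: (simple_quotient_max (Fm _ FM) (hw (exist _ M FM))).
- move=> m a u v; have [x ->] := quotient_pi_surj u; have [y ->] := quotient_pi_surj v.
  by rewrite -quotient_piZ -quotient_piD !fq quotient_piD quotient_piZ.
- by split.
split.
  move=> u; apply: cvg_prod_topology.
    exact: (@fmap_filter _ _ f (nbhs u) (nbhs_filter u)).
  move=> m V /nbhs_singleton Vm.
  have [_ [i Ki]] := Fm _ (svalP m).
  have [x ux] := quotient_pi_surj u.
  apply: (@filterS _ _ _ [set v | f v m = f u m]); first by move=> v /= e; rewrite /= e.
  apply: open_nbhs_nbhs; split=> //.
  apply/open_quotient_pi; apply: (@open_saturated _ i) => y z /= + Kyz; rewrite !fq => <-.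
  exact/qw/Ki.
move=> s O; rewrite nbhsE => -[O' [/open_quotient_pi oO' O's] OO].
have [x gx] := quotient_pi_surj (g s).
have : nbhs (x : A) (quotient_pi W @^-1` O').
  by apply: open_nbhs_nbhs; split=> //; rewrite /= -gx.
move=> /nbhsK[i hi].
(* Continuity of g at s: with x + K_i inside the open set O' and L, a finite
     intersection of members of F, inside J + K_i, it is enough that t agrees with s at
     the finitely many M that define L. *)
have [L FL sL] := @chevalley _ _ _ hK hart F i (fun M FM =>
  conj (bopen_closed (hm _ FM) (Fm _ FM).2) (hm _ FM)).
have : nbhs s [set t | forall y, g t = quotient_pi W y -> L ((y : A) - x)].
  elim: {sL} FL => [|{}L M _ IH FM]; first exact: filterS filterT.
  have hc := @nbhs_cylinder _ _ s (exist _ M FM) [set s (exist _ M FM)].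
  have /hc hs : nbhs (s (exist _ M FM)) [set s (exist _ M FM)].
    apply: open_nbhs_nbhs; split=> //.
    exact: (open_quotient_max (Fm _ FM) (hw (exist _ M FM))).
  apply: filterS (filterI IH hs) => t [h1 /= h2] y gy; split; first exact: h1.
  by apply/(qw (exist _ M FM)); rewrite -!fq -gy -gx !fg.
apply: filterS => t ht; apply: OO.
have [y gy] := quotient_pi_surj (g t); have [j hj Kj] := sL _ (ht _ gy).
rewrite FJ in hj; rewrite /= gy.
have -> : quotient_pi W y = quotient_pi W ((y : A) - j).
  by apply/qW; rewrite opprB addrCA subrr addr0.
by apply: hi; rewrite addrAC.
Qed.

Lemma jacobson_sub_product_of_simples (V : set A) :
  closed_with_product_of_simples_quotient V -> @jacobson A `<=` V.
Proof.
move=> [W [-> _ [X [S [f [g [sS flin [fK _] _]]]]]]] a qa.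
suff /(quotient_pi_eq W (a : LA) 0) : quotient_pi W (a : A) = quotient_pi W 0 by rewrite subr0.
rewrite quotient_pi0 -[a]mulr1 -[a * 1]/((a : A) *: (1 : LA)) quotient_piZ.
have f0 m : f 0 m = 0.
  have := flin m (-1) 0 0; rewrite scaler0 addr0 => ->.
  by rewrite scaleN1r addNr.
apply: (can_inj fK); apply: functional_extensionality_dep => m.
rewrite f0 -[_ *: _]addr0 (flin m) f0 addr0.
exact: jacobson_annihilator (sS m) qa _.
Qed.

End Topology.

(** * The characterizations of the radical *)

Theorem proposition3p2 (k : fieldType) (A : preTopologicalPzAlgType k)
    (hA : pseudocompact_algebra A) :
  exists J : set A,
    J = \bigcap_(I in maximal_proper (@closed_left_ideal k A)) I /\
    J = \bigcap_(I in maximal_proper (@closed_right_ideal k A)) I /\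
    J = \bigcap_(I in maximal_proper (@closed_ideal k A)) I /\
    J = \bigcap_(I in maximal_proper (@left_ideal k A)) I /\
    J = [set x | forall y : A, left_invertible (1 - y * x)] /\
    J = [set x | forall y z : A, invertible (1 - y * x * z)] /\
    J = [set a | non_generator a] /\
    J = [set a | topological_non_generator a] /\
    J = [set a | forall S : preTopologicalModType A,
        simple_pseudocompact S -> annihilator S a] /\
    is_smallest (@closed_with_product_of_simples_quotient k A) J /\
    is_largest (@closed_pronilpotent_ideal k A) J.
Proof.
have [I [K [hK hfd nbhsK]]] := pseudocompact_base_of_algebra hA.
have hart := artinian_fcodim hfd.
have closedK := closed_left_idealE hK nbhsK.
exists (@jacobson A).
refine (conj _ (conj _ (conj _ (conj _ (conj _ (conj _ (conj _ (conj _
  (conj _ (conj _ _)))))))))).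
- by rewrite closedK (jacobson_open_maximal hK) (open_maximalE hK).
- rewrite (closed_right_idealE hK nbhsK) -[LHS]jacobson_conv.
  have hKc := pseudocompact_base_conv hK.
  by rewrite (jacobson_open_maximal hKc) (open_maximalE hKc).
- by rewrite (closed_idealE hK nbhsK) (jacobson_twosided hK hart).
- exact: jacobson_maximal.
- by [].
- exact: jacobsonE.
- rewrite jacobson_maximal; apply: bigcap_maximal_nongenerator.
    exact: lideal_bigcap.
  move=> L hL LT; apply: ex_maximal => // L1; exact/LT/lideal1.
- rewrite (jacobson_open_maximal hK) (open_maximalE hK) -closedK.
  apply: bigcap_maximal_nongenerator.
    rewrite closedK => F hF; split.
      by apply: bclosed_bigcap => L /hF[].
    by apply: lideal_bigcap => L /hF[].
  rewrite closedK => L hL LT; rewrite -(open_maximalE hK); apply: (ex_open_maximal hK) => // L1.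
  by apply/LT/lideal1 => //; case: hL.
- exact: jacobson_annihilators hK hfd nbhsK.
- split; first exact: product_of_simples_jacobson hK hfd nbhsK.
  by move=> V; apply: jacobson_sub_product_of_simples.
have powE (L : set A) : \bigcap_n closed_power L n = \bigcap_n bpower K L n.
  by apply: eq_bigcapr => n _; apply: (closed_powerE hK nbhsK).
split.
  split; last by rewrite /pronilpotent powE; apply: jacobson_pronilpotent.
  rewrite (closed_idealE hK nbhsK); split; first exact: bclosed_jacobson.
  exact: tideal_jacobson.
move=> L; rewrite /closed_pronilpotent_ideal (closed_idealE hK nbhsK).
by rewrite /pronilpotent powE => -[hL]; apply: pronilpotent_sub_jacobson.
Qed.
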